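(* Every $\mathsf{Sym}$-algebra in $\mathit{Cat}^{\mathcal I}$ is related to a strictly commutative $\mathcal I$-category monoid by a chain of $\mathcal I$-equivalences in $\mathsf{Sym}\text{-}\mathit{Cat}^{\mathcal I}$.
   Context: $\mathcal I$ is the category with objects the finite sets $\mathbf n=\{1,\dots,n\}$, $n\ge0$ ($\mathbf 0=\emptyset$), and all injective functions as morphisms. It is symmetric strict monoidal under concatenation $\mathbf m\sqcup\mathbf n=\mathbf{m+n}$ with unit $\mathbf 0$ and symmetry the block permutations $\chi_{\mathbf m,\mathbf n}\colon\mathbf m\sqcup\mathbf n\to\mathbf n\sqcup\mathbf m$. $\mathit{Cat}$ is the category of small categories; an $\mathcal I$-category is a functor $\mathcal I\to\mathit{Cat}$, and $\mathit{Cat}^{\mathcal I}$ is the category of these, symmetric monoidal under Day convolution $\boxtimes$ with respect to $\sqcup$. An $\mathcal I$-category monoid is a monoid in $\mathit{Cat}^{\mathcal I}$, i.e. an $\mathcal I$-category $A$ with a unit object in $A(\mathbf 0)$ and associative, unital functors $\otimes\colon A(\mathbf m)\times A(\mathbf n)\to A(\mathbf m\sqcup\mathbf n)$ natural in $(\mathbf m,\mathbf n)\in\mathcal I\times\mathcal I$. It is strictly commutative if $A(\chi_{\mathbf m,\mathbf n})(\mathbf a\otimes\mathbf b)=\mathbf b\otimes\mathbf a$ for all $\mathbf m,\mathbf n$, on objects and morphisms. $\mathsf{Sym}$ is the operad in $\mathit{Cat}$ for which $\mathsf{Sym}(k)$ has as objects the elements of $\Sigma_k$ and a morphism $\alpha\colon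 a\to b$ is an element $\alpha\in\Sigma_k$ with $\alpha a=b$; $\Sigma_k$ acts by right multiplication, and the structure maps are $\gamma(a,b_1,\dots,b_k)=a(j_1,\dots,j_k)\circ(b_1\sqcup\dots\sqcup b_k)$ on objects, where $a(j_1,\dots,j_k)$ is the block permutation (this determines $\gamma$ on morphisms). A $\mathsf{Sym}$-algebra in $\mathit{Cat}^{\mathcal I}$ is an algebra for the monad $X\mapsto\coprod_{k\ge0}\mathsf{Sym}(k)\times_{\Sigma_k}X^{\boxtimes k}$ on $\mathit{Cat}^{\mathcal I}$; $\mathsf{Sym}\text{-}\mathit{Cat}^{\mathcal I}$ is the category of these. Strictly commutative $\mathcal I$-category monoids are regarded as $\mathsf{Sym}$-algebras via the projections $\mathsf{Sym}(k)\to *$. The Grothendieck construction $\mathcal I\!\int\! X$ of an $\mathcal I$-category $X$ has objects $(\mathbf n,\mathbf x)$ with $\mathbf x\in X(\mathbf n)$, and morphisms $(\mathbf m,\mathbf x)\to(\mathbf n,\mathbf y)$ the pairs of $\alpha\colon\mathbf m\to\mathbf n$ in $\mathcal I$ and $s\colon X(\alpha)(\mathbf x)\to\mathbf y$ in $X(\mathbf n)$. A functor between small categories is a weak equivalence if its nerve is a weak equivalence of simplicial sets. A map $X\to Y$ of $\mathcal I$-categories is an $\mathcal I$-equivalence if $\mathcal I\!\int\! X\to\mathcal I\!\int\! Y$ is a weak equivalence; $\mathcal I$-equivalences in $\mathsf{Sym}\text{-}\mathit{Cat}^{\mathcal I}$ are morphisms of $\mathsf{Sym}$-algebras whose underlying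 maps are $\mathcal I$-equivalences. *)

(* Defs.v *)
Set Warnings "-notation-overridden".
From mathcomp Require Import all_boot all_order all_fingroup boolp.
From Stdlib Require Import Relation_Operators.

Set Implicit Arguments.
Unset Strict Implicit.
Unset Printing Implicit Defensive.

(** Propositional and functional extensionality (hence proof irrelevance) are
  assumed through [boolp], so that Leibniz equality of functors is equality on
  objects and on morphisms; all strict equations are stated in this form. *)

Record category := Category {
  ob :> Type;
  hom : ob -> ob -> Type;
  idm : forall x, hom x x;
  comp : forall x y z, hom y z -> hom x y -> hom x z;
  comp1m : forall x y (f : hom x y), comp (idm y) f = f;
  compm1 : forall x y (f : hom x y), comp f (idm x) = f;
  compA : forall x y z w (h : hom z w) (g : hom y z) (f : hom x y),
    comp h (comp g f) = comp (comp h g) f }.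

Arguments idm {c} x.
Arguments comp {c x y z} g f.
Notation "g \oc f" := (comp g f) (at level 40, left associativity).

Record functor (C D : category) := Functor {
  fob :> C -> D;
  fmap : forall x y, hom x y -> hom (fob x) (fob y);
  fmap1 : forall x, fmap (idm x) = idm (fob x);
  fmapM : forall x y z (g : hom y z) (f : hom x y),
    fmap (g \oc f) = fmap g \oc fmap f }.

Arguments fmap {C D} f {x y} u : rename.

Lemma functor_irr (C D : category) (o : C -> D)
    (m : forall x y, hom x y -> hom (o x) (o y)) p q p' q' :
  @Functor C D o m p q = @Functor C D o m p' q'.
Proof. by congr Functor; apply: Prop_irrelevance. Qed.

Section FunctorConstructions.
Context {C D E : category}.

Definition fid : functor C C.
Proof. by exists (fun x => x) (fun x y f => f). Defined.

Definition fcomp (G : functor D E) (F : functor C D) : functor C E.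
Proof.
exists (fun x => G (F x)) (fun x y f => fmap G (fmap F f)).
- by move=> x; rewrite !fmap1.
- by move=> x y z g f; rewrite !fmapM.
Defined.

Definition fconst (d : D) : functor C D.
Proof.
exists (fun=> d) (fun _ _ _ => idm d) => // *.
by rewrite comp1m.
Defined.

End FunctorConstructions.

Arguments fid : clear implicits.
Notation "G \oF F" := (fcomp G F) (at level 40, left associativity).

Lemma fcomp1f C D (F : functor C D) : fid D \oF F = F.
Proof. by case: F => o m p q; apply: functor_irr. Qed.

Lemma fcompf1 C D (F : functor C D) : F \oF fid C = F.
Proof. by case: F => o m p q; apply: functor_irr. Qed.

Lemma fcompA C D E B (H : functor E B) (G : functor D E) (F : functor C D) :
  H \oF (G \oF F) = H \oF G \oF F.
Proof. exact: functor_irr. Qed.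

Definition prod_cat (C D : category) : category.
Proof.
exists (C * D)%type (fun x y => hom x.1 y.1 * hom x.2 y.2)%type
  (fun x => (idm x.1, idm x.2)) (fun x y z g f => (g.1 \oc f.1, g.2 \oc f.2)).
- by move=> x y [f1 f2] /=; rewrite !comp1m.
- by move=> x y [f1 f2] /=; rewrite !compm1.
- by move=> x y z w [h1 h2] [g1 g2] [f1 f2] /=; rewrite !compA.
Defined.

Definition pi_cat (I : Type) (C : I -> category) : category.
Proof.
exists (forall i, C i) (fun x y => forall i, hom (x i) (y i))
  (fun x i => idm (x i)) (fun x y z g f i => g i \oc f i).
- by move=> x y f; apply: functional_extensionality_dep => i; apply: comp1m.
- by move=> x y f; apply: functional_extensionality_dep => i; apply: compm1.
- by move=> *; apply: functional_extensionality_dep => i; apply: compA.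
Defined.

Section Products.
Context {C D E : category}.

Definition ffst : functor (prod_cat C D) C.
Proof. by exists (fun x => x.1) (fun x y f => f.1). Defined.

Definition fsnd : functor (prod_cat C D) D.
Proof. by exists (fun x => x.2) (fun x y f => f.2). Defined.

Definition fpair (F : functor E C) (G : functor E D) :
  functor E (prod_cat C D).
Proof.
exists (fun x => (F x, G x)) (fun x y f => (fmap F f, fmap G f)).
- by move=> x; rewrite !fmap1.
- by move=> x y z g f; rewrite !fmapM.
Defined.

Context {I : Type} {B : I -> category}.

Definition fproj (i : I) : functor (pi_cat B) (B i).
Proof. by exists (fun x => x i) (fun x y f => f i). Defined.

Definition ftuple (F : forall i, functor E (B i)) : functor E (pi_cat B).
Proof.
exists (fun x i => F i x) (fun x y f i => fmap (F i) f).
- by move=> x; apply: functional_extensionality_dep => i; rewrite fmap1.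
- by move=> *; apply: functional_extensionality_dep => i; rewrite fmapM.
Defined.

End Products.

Definition fprod C D C' D' (F : functor C C') (G : functor D D') :
    functor (prod_cat C D) (prod_cat C' D') :=
  fpair (F \oF ffst) (G \oF fsnd).

Definition fpi I (B B' : I -> category) (F : forall i, functor (B i) (B' i)) :
    functor (pi_cat B) (pi_cat B') :=
  ftuple (fun i => F i \oF fproj i).

Definition idto (C : category) (x y : C) (e : x = y) : hom x y :=
  let: erefl := e in idm x.

Lemma idto_id (C : category) (x : C) (e : x = x) : idto e = idm x.
Proof. by rewrite (Prop_irrelevance e erefl). Qed.

Lemma idto_irr (C : category) (x y : C) (e e' : x = y) : idto e = idto e'.
Proof. by rewrite (Prop_irrelevance e e'). Qed.

Lemma idtoM (C : category) (x y z : C) (e2 : y = z) (e1 : x = y) :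
  idto e2 \oc idto e1 = idto (etrans e1 e2).
Proof. by case: z / e2; rewrite comp1m. Qed.

Lemma fmap_idto C D (F : functor C D) x y (e : x = y) (e' : F x = F y) :
  fmap F (idto e) = idto e'.
Proof. by case: y / e e' => e'; rewrite !idto_id fmap1. Qed.

Lemma idto_nat C D (F G : functor C D) (e : F = G) x y (f : hom x y)
    (ex : F x = G x) (ey : F y = G y) :
  fmap G f \oc idto ex = idto ey \oc fmap F f.
Proof. by case: G / e ex ey => ex ey; rewrite !idto_id comp1m compm1. Qed.

(** The object n = {1, ..., n} of the category I is represented by ['I_n]. *)

Record injection (m n : nat) := Injection {
  inj_fun :> {ffun 'I_m -> 'I_n};
  inj_funP : injectiveb inj_fun }.

Lemma injection_inj m n (f : injection m n) : injective f.
Proof. exact/injectiveP/inj_funP. Qed.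

Lemma injection_eq m n (f g : injection m n) : f =1 g -> f = g.
Proof.
case: f g => [f fP] [g gP] /= /ffunP efg.
by case: g / efg gP => gP; congr Injection; apply: bool_irrelevance.
Qed.

Fact inj_ofP m n (f : 'I_m -> 'I_n) (fI : injective f) : injectiveb (finfun f).
Proof. by apply/injectiveP => x y; rewrite !ffunE; apply: fI. Qed.

Definition inj_of m n (f : 'I_m -> 'I_n) (fI : injective f) : injection m n :=
  Injection (inj_ofP fI).

Lemma inj_ofE m n (f : 'I_m -> 'I_n) (fI : injective f) : inj_of fI =1 f.
Proof. exact: ffunE. Qed.

Definition injection_id n : injection n n := inj_of (@inj_id 'I_n).

Definition injection_comp l m n (g : injection m n) (f : injection l m) :
    injection l n :=
  inj_of (inj_comp (@injection_inj _ _ g) (@injection_inj _ _ f)).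

Lemma injection_idE n i : injection_id n i = i.
Proof. exact: inj_ofE. Qed.

Lemma injection_compE l m n (g : injection m n) (f : injection l m) i :
  injection_comp g f i = g (f i).
Proof. exact: inj_ofE. Qed.

Definition inj_cat : category.
Proof.
exists nat injection injection_id injection_comp.
- by move=> *; apply: injection_eq => i; rewrite injection_compE injection_idE.
- by move=> *; apply: injection_eq => i; rewrite injection_compE injection_idE.
- by move=> *; apply: injection_eq => i; rewrite !injection_compE.
Defined.

(** Objects of I such as m + (n + p) and (m + n) + p are equal, but not
  convertible. Strict equations involving them are stated by applying the
  identity morphism between equal objects. *)
Definition inj_cast m n (e : m = n) : injection m n :=
  inj_of (@cast_ord_inj m n e).

Section BinaryConcatenation.
Variables m n m' n' : nat.

Fact inj_add_subproof (f : injection m m') (g : injection n n') :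
  injective (fun i : 'I_(m + n) =>
    match split i with inl a => lshift n' (f a) | inr b => rshift m' (g b) end).
Proof.
move=> i j; case: (splitP i) => a ia; case: (splitP j) => b jb /eqP.
- by rewrite eq_lshift => /eqP/injection_inj ab; apply: ord_inj; rewrite ia jb ab.
- by rewrite eq_lrshift.
- by rewrite eq_rlshift.
- by rewrite eq_rshift => /eqP/injection_inj ab; apply: ord_inj; rewrite ia jb ab.
Qed.

Definition inj_add (f : injection m m') (g : injection n n') :
    injection (m + n) (m' + n') :=
  inj_of (@inj_add_subproof f g).

Fact chi_subproof : injective (fun i : 'I_(m + n) =>
  match split i with inl a => rshift n a | inr b => lshift m b end).
Proof.
move=> i j; case: (splitP i) => a ia; case: (splitP j) => b jb /eqP.
- by rewrite eq_rshift => /eqP ab; apply: ord_inj; rewrite ia jb ab.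
- by rewrite eq_rlshift.
- by rewrite eq_lrshift.
- by rewrite eq_lshift => /eqP ab; apply: ord_inj; rewrite ia jb ab.
Qed.

Definition chi : injection (m + n) (n + m) := inj_of chi_subproof.

End BinaryConcatenation.

(** The k-fold concatenation of [n_1], ..., [n_k] is [\sum_i n i]. The bijection
  [tagnat.rank] with the disjoint union is lexicographic ([tagnat.rankEsum]):
  it sends (i, t) to n_1 + ... + n_(i-1) + t. *)

Section Concatenation.
Variable k : nat.

Section Sum.
Variables (m n : 'I_k -> nat) (f : forall i, injection (m i) (n i)).

Fact inj_sum_subproof : injective (fun s : 'I_(\sum_i m i) =>
  tagnat.Rank (tagnat.sig1 s) (f (tagnat.sig1 s) (tagnat.sig2 s))
    : 'I_(\sum_i n i)).
Proof.
move=> s t /(congr1 val)/eqP; rewrite /= tagnat.eq_Rank => E.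
apply: tagnat.sig_inj; rewrite !tagnat.sigE12.
move: (tagnat.sig1 s) (tagnat.sig2 s) (tagnat.sig1 t) (tagnat.sig2 t) E.
move=> i a j b /andP[/eqP ij].
by case: j / ij b => b /eqP/val_inj/injection_inj ->.
Qed.

Definition inj_sum : injection (\sum_i m i) (\sum_i n i) :=
  inj_of inj_sum_subproof.

End Sum.

(** The block permutation s(n_1, ..., n_k), from the concatenation of
  n_1, ..., n_k to that of n_(s^-1 1), ..., n_(s^-1 k): it moves the i-th block
  to the position s i, preserving the order inside each block. *)

Variables (s : 'S_k) (n : 'I_k -> nat).

Fact block_subproof : injective (fun u : 'I_(\sum_i n i) =>
  tagnat.Rank (s (tagnat.sig1 u))
    (cast_ord (congr1 n (esym (permK s (tagnat.sig1 u)))) (tagnat.sig2 u))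
    : 'I_(\sum_i n ((s^-1)%g i))).
Proof.
move=> u v /(congr1 val)/eqP; rewrite tagnat.eq_Rank => /andP[/eqP/perm_inj e].
move=> /eqP /= e2; apply: tagnat.sig_inj; rewrite !tagnat.sigE12.
move: (tagnat.sig1 u) (tagnat.sig2 u) (tagnat.sig1 v) (tagnat.sig2 v) e e2.
by move=> i a j b ij; case: j / ij b => b /val_inj ->.
Qed.

Definition block : injection (\sum_i n i) (\sum_i n ((s^-1)%g i)) :=
  inj_of block_subproof.

Lemma block_sum : \sum_i n ((s^-1)%g i) = \sum_i n i.
Proof. by rewrite [RHS](reindex_inj (@perm_inj _ (s^-1)%g)). Qed.

End Concatenation.

Lemma sum_ord0 (n : 'I_0 -> nat) : 0 = \sum_i n i.
Proof. by rewrite big_ord0. Qed.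

Lemma sum_ord1 (n : nat) : \sum_(i < 1) n = n.
Proof. by rewrite big_ord1. Qed.

Lemma sum_ordS k (n : 'I_k.+1 -> nat) :
  n ord0 + \sum_i n (lift ord0 i) = \sum_i n i.
Proof. by rewrite big_ord_recl. Qed.

Lemma flatten_sum k (j : 'I_k -> nat) (n : forall i, 'I_(j i) -> nat) :
  \sum_i \sum_t n i t = \sum_s n (tagnat.sig1 s) (tagnat.sig2 s).
Proof.
have reindexT (F : {i : 'I_k & 'I_(j i)} -> nat) :
    \sum_s F (tagnat.sig s) = \sum_u F u.
  by rewrite [RHS](reindex tagnat.sig) //; apply: tagnat.sig_bij_on.
rewrite (reindexT (fun u => n (tag u) (tagged u))) /=.
exact: (@sig_big_dep _ _ _ _ (fun i => 'I_(j i)) xpredT (fun=> xpredT) n).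
Qed.

Record icategory := ICategory {
  icat_ob :> nat -> category;
  icat_map : forall m n, injection m n -> functor (icat_ob m) (icat_ob n);
  icat_map1 : forall n, icat_map (injection_id n) = fid (icat_ob n);
  icat_mapM : forall l m n (g : injection m n) (f : injection l m),
    icat_map (injection_comp g f) = icat_map g \oF icat_map f }.

Arguments icat_map X {m n} f : rename.

Record imap (X Y : icategory) := IMap {
  imap_at :> forall n, functor (X n) (Y n);
  imap_nat : forall m n (f : injection m n),
    icat_map Y f \oF imap_at m = imap_at n \oF icat_map X f }.

Section Grothendieck.
Variable X : icategory.

Definition groth_ob : Type := {n : nat & X n}.

Definition groth_hom (p q : groth_ob) : Type :=
  {a : injection (tag p) (tag q) & hom (icat_map X a (tagged p)) (tagged q)}.

Lemma icat_ob1 n (x : X n) : icat_map X (injection_id n) x = x.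
Proof. by rewrite icat_map1. Qed.

Lemma icat_obM l m n (g : injection m n) (f : injection l m) (x : X l) :
  icat_map X (injection_comp g f) x = icat_map X g (icat_map X f x).
Proof. by rewrite icat_mapM. Qed.

(** The sources and targets of the [idto] below are equal by functoriality of X,
  but not convertible. *)
Definition groth_id (p : groth_ob) : groth_hom p p :=
  existT _ (injection_id (tag p)) (idto (icat_ob1 (tagged p))).

Definition groth_comp (p q r : groth_ob)
    (g : groth_hom q r) (f : groth_hom p q) : groth_hom p r :=
  existT _ (injection_comp (tag g) (tag f))
    (tagged g \oc fmap (icat_map X (tag g)) (tagged f)
       \oc idto (icat_obM (tag g) (tag f) (tagged p))).

Lemma groth_hom_eq (p q : groth_ob) (f g : groth_hom p q) (e : tag f = tag g) :
  tagged f = tagged g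
      \oc idto (congr1 (fun a => icat_map X a (tagged p)) e) ->
  f = g.
Proof.
case: f g e => [a s] [b t] /= e; case: b / e t => t ->.
by rewrite idto_id compm1.
Qed.

Definition groth : category.
Proof.
exists groth_ob groth_hom groth_id groth_comp.
- move=> p q [a s].
  have e : injection_comp (injection_id _) a = a := @comp1m inj_cat _ _ a.
  apply: (@groth_hom_eq _ _ (groth_comp (groth_id q) (existT _ a s)) (existT _ a s) e) => /=.
  rewrite -(idto_nat (icat_map1 X _) s (icat_ob1 _)) -compA.
  by rewrite idtoM; congr (_ \oc _); apply: idto_irr.
- move=> p q [a s].
  have e : injection_comp a (injection_id _) = a := @compm1 inj_cat _ _ a.
  apply: (@groth_hom_eq _ _ (groth_comp (existT _ a s) (groth_id p)) (existT _ a s) e) => /=.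
  rewrite (fmap_idto _ (congr1 (icat_map X a) (icat_ob1 _))) -compA.
  by rewrite idtoM; congr (_ \oc _); apply: idto_irr.
- move=> p q r t [c u] [b v] [a s].
  have e : injection_comp c (injection_comp b a)
      = injection_comp (injection_comp c b) a := @compA inj_cat _ _ _ _ c b a.
  apply: (@groth_hom_eq _ _
      (groth_comp (existT _ c u) (groth_comp (existT _ b v) (existT _ a s)))
      (groth_comp (groth_comp (existT _ c u) (existT _ b v)) (existT _ a s)) e)
    => /=.
  rewrite !fmapM (fmap_idto _ (congr1 (icat_map X c) (icat_obM _ _ _))).
  rewrite -!compA; congr (_ \oc (_ \oc _)); rewrite !idtoM compA.
  rewrite -(idto_nat (icat_mapM X c b) s (icat_obM _ _ _)) -compA idtoM.
  by congr (_ \oc _); apply: idto_irr.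
Defined.

End Grothendieck.

Section GrothendieckMap.
Variables (X Y : icategory) (F : imap X Y).

Lemma imap_ob m n (f : injection m n) (x : X m) :
  icat_map Y f (F m x) = F n (icat_map X f x).
Proof. exact: (congr1 (fun H : functor _ _ => H x) (imap_nat F f)). Qed.

Definition groth_map_ob (p : groth X) : groth Y :=
  existT _ (tag p) (F (tag p) (tagged p)).

Definition groth_map_hom (p q : groth X) (f : hom p q) :
    hom (groth_map_ob p) (groth_map_ob q) :=
  existT _ (tag f) (fmap (F (tag q)) (tagged f)
                      \oc idto (imap_ob (tag f) (tagged p))).

Definition groth_map : functor (groth X) (groth Y).
Proof.
exists groth_map_ob groth_map_hom.
- move=> p.
  apply: (@groth_hom_eq _ _ _ (groth_map_hom (groth_id p)) (groth_id _) erefl).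
  rewrite /= compm1 (fmap_idto _ (congr1 (F (tag p)) (icat_ob1 _))).
  by rewrite idtoM; apply: idto_irr.
- move=> p q r [b t] [a s].
  apply: (@groth_hom_eq _ _ _
      (groth_map_hom (groth_comp (existT _ b t) (existT _ a s)))
      (groth_comp (groth_map_hom (existT _ b t)) (groth_map_hom (existT _ a s)))
      erefl) => /=.
  rewrite !fmapM compm1 (fmap_idto _ (congr1 (F _) (icat_obM _ _ _))).
  rewrite (fmap_idto _ (congr1 (icat_map Y b) (imap_ob _ _))).
  rewrite -!compA; congr (_ \oc _).
  rewrite !idtoM compA.
  rewrite -(idto_nat (imap_nat F b) s (imap_ob _ _)).
  rewrite -compA idtoM.
  by congr (_ \oc _); apply: idto_irr.
Defined.

End GrothendieckMap.

(** The linear order [n] = {0 < ... < n} of the simplex category is ['I_n.+1]. *)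

Record monotone (m n : nat) := Monotone {
  mono_fun :> {ffun 'I_m.+1 -> 'I_n.+1};
  mono_funP : [forall i : 'I_m.+1, forall j : 'I_m.+1, (i <= j) ==> (mono_fun i <= mono_fun j)] }.

Lemma mono_le m n (f : monotone m n) (i j : 'I_m.+1) : i <= j -> f i <= f j.
Proof. by move=> ij; exact: (implyP (forallP (forallP (mono_funP f) i) j) ij). Qed.

Lemma monotone_eq m n (f g : monotone m n) : f =1 g -> f = g.
Proof.
case: f g => [f fP] [g gP] /= /ffunP efg.
by case: g / efg gP => gP; congr Monotone; apply: bool_irrelevance.
Qed.

Fact mono_ofP m n (f : 'I_m.+1 -> 'I_n.+1)
    (fM : forall i j : 'I_m.+1, i <= j -> f i <= f j) :
  [forall i : 'I_m.+1, forall j : 'I_m.+1, (i <= j) ==> (finfun f i <= finfun f j)].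
Proof. by do 2!apply/forallP=> ?; apply/implyP => /fM; rewrite !ffunE. Qed.

Definition mono_of m n (f : 'I_m.+1 -> 'I_n.+1)
    (fM : forall i j : 'I_m.+1, i <= j -> f i <= f j) : monotone m n :=
  Monotone (mono_ofP fM).

Lemma mono_ofE m n (f : 'I_m.+1 -> 'I_n.+1) fM : @mono_of m n f fM =1 f.
Proof. exact: ffunE. Qed.

Definition mono_id n : monotone n n := @mono_of n n id (fun i j ij => ij).

Definition mono_comp l m n (g : monotone m n) (f : monotone l m) :
    monotone l n :=
  @mono_of l n (g \o f) (fun i j ij => mono_le g (mono_le f ij)).

Definition mono_const m n (c : 'I_n.+1) : monotone m n :=
  @mono_of m n (fun=> c) (fun i j ij => leqnn c).

Lemma mono_idE n i : mono_id n i = i.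
Proof. exact: mono_ofE. Qed.

Lemma mono_compE l m n (g : monotone m n) (f : monotone l m) i :
  mono_comp g f i = g (f i).
Proof. exact: mono_ofE. Qed.

Lemma mono_compf1 m n (f : monotone m n) : mono_comp f (mono_id m) = f.
Proof. by apply: monotone_eq => i; rewrite mono_compE mono_idE. Qed.

Lemma mono_compA l m n p (h : monotone n p) (g : monotone m n)
    (f : monotone l m) :
  mono_comp h (mono_comp g f) = mono_comp (mono_comp h g) f.
Proof. by apply: monotone_eq => i; rewrite !mono_compE. Qed.

Record sset := SSet {
  simplices :> nat -> Type;
  sact : forall m n, monotone m n -> simplices n -> simplices m;
  sact1 : forall n x, sact (mono_id n) x = x;
  sactM : forall l m n (g : monotone m n) (f : monotone l m) x,
    sact (mono_comp g f) x = sact f (sact g x) }.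

Arguments sact X {m n} f x : rename.

Record smap (X Y : sset) := SMap {
  smap_at :> forall n, X n -> Y n;
  smap_nat : forall m n (f : monotone m n) x,
    sact Y f (smap_at x) = smap_at (sact X f x) }.

Arguments smap_at {X Y} f n x : rename.

Definition smap_comp X Y Z (g : smap Y Z) (f : smap X Y) : smap X Z.
Proof.
exists (fun n x => g n (f n x)) => m n a x.
by rewrite !smap_nat.
Defined.

Definition sprod (X Y : sset) : sset.
Proof.
exists (fun n => X n * Y n)%type (fun m n f x => (sact X f x.1, sact Y f x.2)).
- by move=> n [x y] /=; rewrite !sact1.
- by move=> l m n g f [x y] /=; rewrite !sactM.
Defined.

Definition simplex (n : nat) : sset.
Proof.
exists (fun m => monotone m n) (fun l m f x => mono_comp x f).
- by move=> m x; apply: mono_compf1.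
- by move=> *; apply: mono_compA.
Defined.

(** The horn: the simplices of [simplex n] contained in the face opposite to j
  for some j != k. *)
Definition in_horn n (k : 'I_n.+1) m (x : monotone m n) : bool :=
  [exists j, (j != k) && [forall i, x i != j]].

Fact in_horn_act n (k : 'I_n.+1) l m (f : monotone l m) (x : monotone m n) :
  in_horn k x -> in_horn k (mono_comp x f).
Proof.
case/existsP=> j /andP[jk /forallP xj]; apply/existsP; exists j.
by rewrite jk; apply/forallP=> i; rewrite mono_compE.
Qed.

Definition horn n (k : 'I_n.+1) : sset.
Proof.
exists (fun m => {x : monotone m n | in_horn k x})
  (fun l m f x => exist _ (mono_comp (sval x) f) (in_horn_act f (svalP x))).
- by move=> m x; apply: val_inj; apply: mono_compf1.
- by move=> *; apply: val_inj; apply: mono_compA.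
Defined.

Definition kan (Z : sset) : Prop :=
  forall n (k : 'I_n.+2) (h : smap (horn k) Z),
  exists g : smap (simplex n.+1) Z, forall m x, g m (sval x) = h m x.

Definition homotopy X Z (f g : smap X Z) : Prop :=
  exists H : smap (sprod X (simplex 1)) Z, forall n x,
    H n (x, mono_const n ord0) = f n x /\ H n (x, mono_const n ord_max) = g n x.

Definition homotopic X Z : smap X Z -> smap X Z -> Prop :=
  clos_refl_sym_trans (smap X Z) (@homotopy X Z).

(** A map f : X -> Y is a weak equivalence if for every Kan complex Z
  precomposition with f is a bijection pi_0 Map(Y, Z) -> pi_0 Map(X, Z); here
  pi_0 Map(X, Z) is the quotient of [smap X Z] by [homotopic]. *)
Definition sset_weak_equivalence X Y (f : smap X Y) : Prop :=
  forall Z, kan Z ->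
    (forall g g' : smap Y Z,
       homotopic (smap_comp g f) (smap_comp g' f) -> homotopic g g') /\
    (forall h : smap X Z, exists g : smap Y Z, homotopic (smap_comp g f) h).

Definition ord_cat (n : nat) : category.
Proof.
exists 'I_n.+1 (fun i j => i <= j) (fun i => leqnn i)
  (fun i j k jk ij => leq_trans ij jk) => *; exact: bool_irrelevance.
Defined.

Definition ord_functor m n (f : monotone m n) : functor (ord_cat m) (ord_cat n).
Proof.
exists (f : ord_cat m -> ord_cat n) (fun i j => @mono_le m n f i j) => *;
  exact: bool_irrelevance.
Defined.

Lemma ord_functor_eq m n (F G : functor (ord_cat m) (ord_cat n)) :
  F =1 G -> F = G.
Proof.
case: F G => [F u p q] [G v p' q'] /= /funext FG.
case: G / FG v p' q' => v p' q'.
have uv : u = v.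
  by do 3!apply: functional_extensionality_dep=> ?; apply: bool_irrelevance.
case: v / uv p' q' => p' q'; exact: functor_irr.
Qed.

Definition nerve (C : category) : sset.
Proof.
exists (fun n => functor (ord_cat n) C) (fun m n f x => x \oF ord_functor f).
- move=> n x; rewrite -[RHS]fcompf1; congr (_ \oF _).
  by apply: ord_functor_eq => i; apply: mono_idE.
- move=> l m n g f x; rewrite -fcompA; congr (_ \oF _).
  by apply: ord_functor_eq => i; apply: mono_compE.
Defined.

Definition nerve_map C D (F : functor C D) : smap (nerve C) (nerve D).
Proof. by exists (fun n x => F \oF x) => *; rewrite /= fcompA. Defined.

Definition weak_equivalence C D (F : functor C D) : Prop :=
  sset_weak_equivalence (nerve_map F).

Definition I_equivalence X Y (F : imap X Y) : Prop :=
  weak_equivalence (groth_map F).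

Record monoid_structure (A : icategory) := MonoidStructure {
  mon_unit : A 0;
  mon_tensor : forall m n, functor (prod_cat (A m) (A n)) (A (m + n));
  mon_nat : forall m m' n n' (f : injection m m') (g : injection n n'),
    icat_map A (inj_add f g) \oF mon_tensor m n
    = mon_tensor m' n' \oF fprod (icat_map A f) (icat_map A g);
  mon_unitl : forall n,
    icat_map A (inj_cast (add0n n))
      \oF mon_tensor 0 n \oF fpair (fconst mon_unit) (fid (A n))
    = fid (A n);
  mon_unitr : forall n,
    icat_map A (inj_cast (addn0 n))
      \oF mon_tensor n 0 \oF fpair (fid (A n)) (fconst mon_unit)
    = fid (A n);
  mon_assoc : forall m n p,
    icat_map A (inj_cast (addnA m n p))
      \oF mon_tensor m (n + p)
      \oF fpair (ffst \oF ffst) (mon_tensor n p \oF fpair (fsnd \oF ffst) fsnd)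
    = mon_tensor (m + n) p \oF fprod (mon_tensor m n) (fid (A p)) }.

Arguments mon_unit {A} M : rename.
Arguments mon_tensor {A} M m n : rename.

Definition strictly_commutative (A : icategory) (M : monoid_structure A) :
    Prop :=
  forall m n, icat_map A (chi m n) \oF mon_tensor M m n
              = mon_tensor M n m \oF fpair fsnd ffst.

Fixpoint iter_tensor (A : icategory) (M : monoid_structure A) (k : nat) :
    forall n : 'I_k -> nat,
    functor (pi_cat (fun i => A (n i))) (A (\sum_i n i)) :=
  match k with
  | 0 => fun n => fconst (icat_map A (inj_cast (sum_ord0 n))
                            (mon_unit M))
  | k'.+1 => fun n =>
      icat_map A (inj_cast (sum_ordS n))
        \oF mon_tensor M _ _
        \oF fpair (fproj ord0)
              (iter_tensor M (fun i => n (lift ord0 i))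
                 \oF ftuple (fun i => fproj (lift ord0 i)))
  end.

(** Products in ['S_k] are composed from left to right: the composite permutation
  written a b (first b, then a) in functional order is [(b * a)%g]. *)

Definition sym_hom k (a b : 'S_k) : Type := {alpha : 'S_k | (a * alpha)%g == b}.

Fact sym_id_subproof k (a : 'S_k) : (a * 1)%g == a.
Proof. by rewrite mulg1. Qed.

Fact sym_comp_subproof k (a b c : 'S_k) (beta : sym_hom b c)
  (alpha : sym_hom a b) : (a * (sval alpha * sval beta))%g == c.
Proof. by rewrite mulgA (eqP (svalP alpha)) (svalP beta). Qed.

Definition sym_cat (k : nat) : category.
Proof.
exists 'S_k (@sym_hom k)
  (fun a => exist (fun x => (a * x)%g == a) 1%g (sym_id_subproof a))
  (fun a b c beta alpha =>
     exist (fun x => (a * x)%g == c) _ (sym_comp_subproof beta alpha)).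
- by move=> *; apply: val_inj; rewrite /= mulg1.
- by move=> *; apply: val_inj; rewrite /= mul1g.
- by move=> *; apply: val_inj; rewrite /= mulgA.
Defined.

Fact sym_act_subproof k (s a b : 'S_k) (alpha : sym_hom a b) :
  (s * a * sval alpha)%g == (s * b)%g.
Proof. by rewrite -mulgA (eqP (svalP alpha)). Qed.

(** The right action of s: [a |-> a s] on objects, [alpha |-> alpha] on
  morphisms. *)
Definition sym_act k (s : 'S_k) : functor (sym_cat k) (sym_cat k).
Proof.
exists (fun a : 'S_k => (s * a)%g : sym_cat k)
  (fun a b alpha => exist (fun x => (s * a * x)%g == (s * b)%g) (sval alpha)
                      (sym_act_subproof s alpha)) => *; exact: val_inj.
Defined.

Definition inj_of_perm k (s : 'S_k) : injection k k := inj_of (@perm_inj _ s).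

Definition perm_of_injection k (f : injection k k) : 'S_k :=
  perm (@injection_inj _ _ f).

Section Gamma.
Variables (k : nat) (j : 'I_k -> nat).

(** The composite of a(j_1, ..., j_k) after b_1 + ... + b_k. *)
Definition gamma (a : 'S_k) (b : forall i, 'S_(j i)) : 'S_(\sum_i j i) :=
  perm_of_injection
    (injection_comp (inj_cast (block_sum a j))
       (injection_comp (block a j) (inj_sum (fun i => inj_of_perm (b i))))).

Fact gamma_hom_subproof (a a' : 'S_k) (b b' : forall i, 'S_(j i)) :
  (gamma a b * ((gamma a b)^-1 * gamma a' b'))%g == gamma a' b'.
Proof. by rewrite mulKVg. Qed.

Definition gamma_functor :
  functor (prod_cat (sym_cat k) (pi_cat (fun i => sym_cat (j i))))
          (sym_cat (\sum_i j i)).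
Proof.
exists (fun x => gamma x.1 x.2 : sym_cat _)
  (fun x y _ => exist (fun c => (gamma x.1 x.2 * c)%g == gamma y.1 y.2) _
                  (gamma_hom_subproof x.1 y.1 x.2 y.2)).
- by move=> x; apply: val_inj; rewrite /= mulVg.
- by move=> *; apply: val_inj; rewrite /= mulgA mulgK.
Defined.

End Gamma.

(** By the universal properties of the Day convolution, of the orbits and of the
  coproduct, a map from [\coprod_k Sym(k) \times_(Sigma_k) A^k] to A is a
  family of functors
    [Sym(k) x A(n_1) x ... x A(n_k) -> A(n_1 + ... + n_k)],
  natural in n_1, ..., n_k ([sym_nat]) and equivariant ([sym_equiv]).
  [sym_unit] and [sym_assoc] are the two axioms of an algebra over the monad.

  Equivariance: the symmetry of the Day convolution lets s act on the k-th power
  of A by (x_1, ..., x_k) |-> (x_(s^-1 1), ..., x_(s^-1 k)), covering the block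
  permutation s(n_1, ..., n_k). Thus (a s, x) and (a, s x) are identified. *)

Record sym_structure (A : icategory) := SymStructure {
  sym_op : forall k (n : 'I_k -> nat),
    functor (prod_cat (sym_cat k) (pi_cat (fun i => A (n i)))) (A (\sum_i n i));
  sym_nat : forall k (m n : 'I_k -> nat) (f : forall i, injection (m i) (n i)),
    icat_map A (inj_sum f) \oF sym_op m
    = sym_op n \oF fprod (fid (sym_cat k)) (fpi (fun i => icat_map A (f i)));
  sym_equiv : forall k (s : 'S_k) (n : 'I_k -> nat),
    icat_map A (block s n) \oF sym_op n
      \oF fprod (sym_act s) (fid (pi_cat (fun i => A (n i))))
    = sym_op (fun i => n ((s^-1)%g i))
      \oF fprod (fid (sym_cat k)) (ftuple (fun i => fproj ((s^-1)%g i)));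
  sym_unit : forall n,
    icat_map A (inj_cast (sum_ord1 n)) \oF sym_op (fun=> n)
      \oF fpair (fconst (1%g : sym_cat 1)) (ftuple (fun=> fid (A n)))
    = fid (A n);
  sym_assoc : forall k (j : 'I_k -> nat) (n : forall i, 'I_(j i) -> nat),
    icat_map A (inj_cast (flatten_sum n))
      \oF sym_op (fun i => \sum_t n i t)
      \oF fprod (fid (sym_cat k)) (fpi (fun i => sym_op (n i)))
    = sym_op (fun s => n (tagnat.sig1 s) (tagnat.sig2 s))
      \oF fpair
            (gamma_functor j
               \oF fprod (fid (sym_cat k)) (fpi (fun i => ffst)))
            (ftuple (fun s => fproj (tagnat.sig2 s) \oF fsnd
                                \oF fproj (tagnat.sig1 s) \oF fsnd)) }.

Arguments sym_op {A} S {k} n : rename.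

Record sym_algebra := SymAlgebra {
  sym_icat :> icategory;
  sym_str : sym_structure sym_icat }.

Definition sym_morphism (A B : sym_algebra) (F : imap A B) : Prop :=
  forall k (n : 'I_k -> nat),
  F (\sum_i n i) \oF sym_op (sym_str A) n
  = sym_op (sym_str B) n \oF fprod (fid (sym_cat k)) (fpi (fun i => F (n i))).

(** S is the Sym-algebra structure obtained from the strictly commutative monoid
  structure M by restriction along the projections Sym(k) -> *. *)
Definition sym_of_monoid (A : icategory) (M : monoid_structure A)
    (S : sym_structure A) : Prop :=
  forall k (n : 'I_k -> nat), sym_op S n = iter_tensor M n \oF fsnd.

Definition sym_I_equivalence (A B : sym_algebra) : Prop :=
  exists2 F : imap A B, sym_morphism F & I_equivalence F.

Definition I_equivalent : sym_algebra -> sym_algebra -> Prop :=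
  clos_refl_sym_trans sym_algebra sym_I_equivalence.

(* Main.v *)
Set Warnings "-notation-overridden".
From mathcomp Require Import all_boot all_order all_fingroup boolp.
From Stdlib Require Import Relation_Operators.
Require Import Defs.

Set Implicit Arguments.
Unset Strict Implicit.
Unset Printing Implicit Defensive.

(** Let E(n) consist of the objects of A(n) equipped with a presentation as an ordered
  product of objects of A in positive degrees, placed along disjoint blocks of n; the
  morphisms of E are those of A. Then E is a Sym-algebra, and E -> A is fully faithful
  and hits every object in positive degree, hence is an I-equivalence. As the blocks
  are disjoint and nonempty, two presentations which only differ by the order of the
  blocks differ by a unique permutation, so the symmetry isomorphisms between them form
  a groupoid with at most one morphism between any two objects, which is stable under
  all operations. The quotient of E by this groupoid is levelwise equivalent to E, and
  Sym(k) acts trivially on it: it is a strictly commutative monoid. *)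

(** * Arrows of a category *)

(** Reordering cannot be divided out in A itself: for [a] in degree zero the symmetry of a ⊗ a may
    be a nontrivial automorphism, whereas strict commutativity would force it to be an identity.
    Disjoint nonempty blocks are told apart by their positions, which rules this out. Only the empty
    product is left in degree zero; this is harmless, because adding a point to n moves the
    Grothendieck construction into positive degrees along a natural transformation from the
    identity. Strict equations between iterated concatenations would need casts. Instead, a factor
    is kept as an injection into a fixed n together with an arrow, and an operation is described by
    ordered lists of factors, so that associativity and equivariance become statements about lists.
    The same description returns at the end, to turn an algebra with trivial action into a
    monoid. *)

Record arr (C : category) := Arr {
  asrc : C;
  atgt : C;
  amor : hom asrc atgt }.

Arguments Arr {C asrc atgt} amor.

Definition amap C D (F : functor C D) (u : arr C) : arr D :=
  Arr (fmap F (amor u)).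

Definition aid (C : category) (x : C) : arr C := Arr (idm x).

Lemma amap_aid C D (F : functor C D) (x : C) : amap F (aid x) = aid (F x).
Proof. by rewrite /amap /= fmap1. Qed.

Section Arrows.
Variable C : category.

Lemma arr_eta (u : arr C) : Arr (amor u) = u.
Proof. by case: u. Qed.

Lemma amor_eq (u v : arr C) (e : u = v)
    (es : asrc u = asrc v) (et : atgt u = atgt v) :
  idto et \oc amor u = amor v \oc idto es.
Proof. by case: v / e es et => es et; rewrite !idto_id comp1m compm1. Qed.

Lemma Arr_inj (x y : C) (f g : hom x y) : Arr f = Arr g -> f = g.
Proof.
by move=> e; have := amor_eq e erefl erefl; rewrite /= comp1m compm1.
Qed.

Lemma Arr_idtor (x y z : C) (f : hom y z) (e : x = y) :
  Arr (f \oc idto e) = Arr f.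
Proof. by case: y / e f => f; rewrite /= compm1. Qed.

Lemma Arr_idtol (x y z : C) (f : hom x y) (e : y = z) :
  Arr (idto e \oc f) = Arr f.
Proof. by case: z / e; rewrite /= comp1m. Qed.

Lemma Arr_idto (x y : C) (e : x = y) : Arr (idto e) = aid x.
Proof. by case: y / e. Qed.

Lemma Arr_comp (x y z x' y' z' : C) (g : hom y z) (f : hom x y)
    (g' : hom y' z') (f' : hom x' y') :
  Arr g = Arr g' -> Arr f = Arr f' -> Arr (g \oc f) = Arr (g' \oc f').
Proof.
move=> eg ef; have ey : y = y' := congr1 (@atgt C) ef.
case: y' / ey g' f' eg ef => g' f' eg ef.
have ex : x = x' := congr1 (@asrc C) ef.
have ez : z = z' := congr1 (@atgt C) eg.
case: x' / ex f' ef => f' /Arr_inj <-; case: z' / ez g' eg => g' /Arr_inj <-.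
by [].
Qed.

End Arrows.

Lemma amap_id C (u : arr C) : amap (fid C) u = u.
Proof. by case: u. Qed.

(** Bundled arrows pay off here: the images of a morphism under two functors are compared by plain
    equality, although their endpoints agree only propositionally. *)
Lemma functor_arr C D (F G : functor C D) : amap F =1 amap G -> F = G.
Proof.
case: F G => [o m p q] [o' m' p' q'] /= e.
have eo : o = o'.
  by apply: funext => x; have /(congr1 (@asrc D)) := e (aid x).
case: o' / eo m' p' q' e => m' p' q' e.
have em : m = m'.
  do 3!apply: functional_extensionality_dep => ?.
  by apply: Arr_inj; apply: (e (Arr _)).
by case: m' / em p' q' {e} => p' q'; apply: functor_irr.
Qed.

Lemma fob_eq C D (F G : functor C D) : F = G -> F =1 G.
Proof. by move=> ->. Qed.

(** Both the presented objects and the representatives of the quotient are organized this way: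
    morphisms are inherited from [C], so [pullF] is fully faithful by construction. *)
Definition pull (C : category) (T : Type) (o : T -> C) : category.
Proof.
exists T (fun x y => hom (o x) (o y)) (fun x => idm (o x))
  (fun x y z g f => g \oc f) => *; [exact: comp1m | exact: compm1 | exact: compA].
Defined.

Definition pullF (C : category) (T : Type) (o : T -> C) : functor (pull o) C.
Proof. by exists (o : pull o -> C) (fun x y f => f). Defined.

Lemma pull_arr (C : category) (T : Type) (o : T -> C) (u v : arr (pull o)) :
  asrc u = asrc v -> atgt u = atgt v -> amap (pullF o) u = amap (pullF o) v ->
  u = v.
Proof.
case: u v => [x y f] [x' y' f'] /= ex ey.
case: x' / ex f' => f'; case: y' / ey f' => f' /Arr_inj /= e.
by congr Arr.
Qed.

Lemma pull_functor (C D : category) (T : Type) (o : T -> C)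
    (F G : functor D (pull o)) :
  F =1 G -> pullF o \oF F = pullF o \oF G -> F = G.
Proof.
move=> e1 e2; apply: functor_arr => -[x y f]; apply: pull_arr; [exact: e1..|].
by have /(congr1 (fun H => amap H (Arr f))) := e2.
Qed.

(** * Concatenation of injections *)

Lemma Rank_eq k (n : 'I_k -> nat) (i i' : 'I_k) (t : 'I_(n i)) (t' : 'I_(n i')) :
  i = i' -> val t = val t' -> tagnat.Rank i t = tagnat.Rank i' t'.
Proof.
move=> ei et; apply/val_inj/eqP; rewrite /= tagnat.eq_Rank.
by apply/andP; split; apply/eqP.
Qed.

(** The type of [sig2 s] depends on [sig1 s], so neither can be rewritten alone; a family [Y] with
    constant codomain lets both be replaced at once. *)
Lemma sig_Rank k (n : 'I_k -> nat) T (Y : forall i, 'I_(n i) -> T) i t :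
  Y (tagnat.sig1 (tagnat.Rank i t)) (tagnat.sig2 (tagnat.Rank i t)) = Y i t.
Proof.
rewrite /tagnat.sig2 /tagnat.sig1.
by have -> : tagnat.sig (tagnat.Rank i t) = Tagged _ t by apply: tagnat.rankK.
Qed.

Lemma injection_sum_eq k (m : 'I_k -> nat) n (f g : injection (\sum_i m i) n) :
  (forall i t, f (tagnat.Rank i t) = g (tagnat.Rank i t)) -> f = g.
Proof. by move=> e; apply: injection_eq => s; rewrite -(tagnat.sig2K s). Qed.

Fact incl_subproof k (n : 'I_k -> nat) i : injective (@tagnat.Rank k n i).
Proof.
move=> t u /(congr1 val)/eqP.
by rewrite tagnat.eq_Rank eqxx => /eqP/val_inj.
Qed.

Definition incl k (n : 'I_k -> nat) i : injection (n i) (\sum_i n i) :=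
  inj_of (@incl_subproof k n i).

Lemma inclE k (n : 'I_k -> nat) i t : incl n i t = tagnat.Rank i t.
Proof. exact: inj_ofE. Qed.

Definition linj m n : injection m (m + n) := inj_of (@lshift_inj m n).
Definition rinj m n : injection n (m + n) := inj_of (@rshift_inj m n).

Lemma linjE m n i : linj m n i = i :> nat.
Proof. by rewrite inj_ofE. Qed.

Lemma rinjE m n i : rinj m n i = m + i :> nat.
Proof. by rewrite inj_ofE. Qed.

Definition disj k (m : 'I_k -> nat) n (a : forall i, injection (m i) n) : Prop :=
  forall i j t u, a i t = a j u -> i = j.

Section Glue.
Context {k : nat} {m : 'I_k -> nat} {n : nat} {a : forall i, injection (m i) n}.

Lemma family_eq i i' (t : 'I_(m i)) (t' : 'I_(m i')) :
  i = i' -> val t = val t' -> a i t = a i' t'.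
Proof. by move=> ei; case: i' / ei t' => t' /val_inj ->. Qed.

Hypothesis d : disj a.

Fact glue_subproof :
  injective (fun s : 'I_(\sum_i m i) => a (tagnat.sig1 s) (tagnat.sig2 s)).
Proof.
move=> s s' e; have e1 := d e; apply: tagnat.sig_inj; rewrite !tagnat.sigE12.
move: (tagnat.sig1 s) (tagnat.sig2 s) (tagnat.sig1 s') (tagnat.sig2 s') e e1.
by move=> i t j u e ij; case: j / ij u e => u /injection_inj ->.
Qed.

(** Concatenation is not a coproduct in I: disjointness of the images is what lets a family of
    injections factor through it. *)
Definition glue : injection (\sum_i m i) n := inj_of glue_subproof.

Lemma glueE i t : glue (tagnat.Rank i t) = a i t.
Proof. by rewrite inj_ofE (sig_Rank (fun i t => a i t)). Qed.

Lemma glue_incl i : injection_comp glue (incl m i) = a i.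
Proof. by apply: injection_eq => t; rewrite injection_compE inclE glueE. Qed.

Lemma disj_comp n' (f : injection n n') : disj (fun i => injection_comp f (a i)).
Proof. by move=> i j t u; rewrite !injection_compE => /injection_inj/d. Qed.

Lemma disj_perm (s : 'S_k) : disj (fun i => a (s i)).
Proof. by move=> i j t u /d/perm_inj. Qed.

End Glue.

Arguments disj_comp {k m n a} d {n'} f i j t u e : rename.
Arguments disj_perm {k m n a} d s i j t u e : rename.

Lemma glue_eq k (m : 'I_k -> nat) n (a : forall i, injection (m i) n)
    (d : disj a) (f : injection (\sum_i m i) n) :
  (forall i t, f (tagnat.Rank i t) = a i t) -> f = glue d.
Proof. by move=> e; apply: injection_sum_eq => i t; rewrite glueE. Qed.

Lemma disj_incl k (n : 'I_k -> nat) : disj (incl n).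
Proof.
move=> i j t u; rewrite !inclE => /(congr1 val)/eqP.
by rewrite tagnat.eq_Rank => /andP[/eqP].
Qed.

Lemma glue_inclE k (n : 'I_k -> nat) : glue (@disj_incl k n) = injection_id _.
Proof. by apply/esym/glue_eq => i t; rewrite injection_idE inclE. Qed.

Lemma inj_sumE k (m n : 'I_k -> nat) (f : forall i, injection (m i) (n i)) i t :
  inj_sum f (tagnat.Rank i t) = tagnat.Rank i (f i t).
Proof. by rewrite inj_ofE (sig_Rank (fun i t => tagnat.Rank i (f i t))). Qed.

Lemma blockE k (s : 'S_k) (n : 'I_k -> nat) i j (t : 'I_(n i))
    (u : 'I_(n ((s^-1)%g j))) :
  s i = j -> val t = val u -> block s n (tagnat.Rank i t) = tagnat.Rank j u.
Proof.
move=> ij tu; rewrite inj_ofE.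
rewrite (sig_Rank (fun i t => @tagnat.Rank _ (fun i => n ((s^-1)%g i)) (s i)
    (cast_ord (congr1 n (esym (permK s i))) t))).
exact: Rank_eq.
Qed.

Lemma glue_block k (s : 'S_k) (m : 'I_k -> nat) n
    (a : forall i, injection (m i) n) (d : disj a)
    (d' : disj (fun i => a ((s^-1)%g i))) :
  injection_comp (glue d') (block s m) = glue d.
Proof.
apply: glue_eq => i t; rewrite injection_compE.
have e : m i = m ((s^-1)%g (s i)) by rewrite permK.
rewrite (@blockE _ s m i (s i) t (cast_ord e t)) // glueE.
by apply: family_eq; rewrite ?permK.
Qed.

Lemma block_incl k (s : 'S_k) (n : 'I_k -> nat) i :
  injection_comp (block s n) (incl n ((s^-1)%g i))
  = incl (fun i => n ((s^-1)%g i)) i.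
Proof.
apply: injection_eq => t; rewrite injection_compE !inclE.
by apply: blockE; rewrite ?permKV.
Qed.

Lemma inj_sum_incl k (m n : 'I_k -> nat) (f : forall i, injection (m i) (n i)) i :
  injection_comp (inj_sum f) (incl m i) = injection_comp (incl n i) (f i).
Proof.
by apply: injection_eq => t; rewrite !injection_compE !inclE inj_sumE.
Qed.

Lemma inj_castE m n (e : m = n) i : inj_cast e i = i :> nat.
Proof. by rewrite inj_ofE. Qed.

(** Both sides shift [w] by the total size of the blocks before [s] in lexicographic order; the left
    side counts them in two stages. *)
Lemma flatten_incl k (j : 'I_k -> nat) (n : forall i, 'I_(j i) -> nat)
    (s : 'I_(\sum_i j i)) :
  injection_comp (inj_cast (flatten_sum n))
    (injection_comp (incl (fun i => \sum_t n i t) (tagnat.sig1 s))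
       (incl (n (tagnat.sig1 s)) (tagnat.sig2 s)))
  = incl (fun s => n (tagnat.sig1 s) (tagnat.sig2 s)) s.
Proof.
apply: injection_eq => w; apply: ord_inj.
rewrite !injection_compE inj_castE !inclE !tagnat.RankEsum addnA.
congr (_ + _); set i0 := tagnat.sig1 s; set t0 := tagnat.sig2 s.
rewrite (reindex (@tagnat.rank k j)) /=; last first.
  by exists tagnat.sig => u _; [exact: tagnat.rankK | exact: tagnat.sigK].
transitivity (\sum_(u : {i & 'I_(j i)} | (u < Tagged (fun i => 'I_(j i)) t0)%O)
   n (tag u) (tagged u)); last first.
  apply: eq_big => [u|u _].
    have e : tagnat.rank (Tagged (fun i => 'I_(j i)) t0) = s := tagnat.sig2K s.
    by rewrite -tagnat.lt_rank e.
  by rewrite tagnat.rankE (sig_Rank n).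
rewrite -(@sig_big_dep _ _ _ _ (fun i => 'I_(j i)) xpredT
  (fun i t => (Tagged (fun i => 'I_(j i)) t < Tagged (fun i => 'I_(j i)) t0)%O) n) /=.
(* Outer indices below [i0] contribute all their inner blocks, [i0] those before [t0], and later
   indices nothing. *)
rewrite [RHS](bigID (fun i : 'I_k => i < i0)) /=; congr (_ + _).
  apply: eq_bigr => i ii0; apply: eq_bigl => t; apply/esym.
  rewrite Order.SigmaOrder.ltEsig /= !Order.OrdinalOrder.leEord (ltnW ii0) /=.
  by rewrite leqNgt ii0.
rewrite [RHS](bigD1 i0) ?ltnn //= [X in _ + X]big1 ?addn0.
  apply: eq_bigl => t; apply/esym.
  exact: (@Order.SigmaOrder.lt_Taggedr _ _ _ (fun i => 'I_(j i)) (Tagged _ t) t0).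
move=> i /andP[ii0 nii0]; rewrite big1 // => t.
rewrite Order.SigmaOrder.ltEsig /= !Order.OrdinalOrder.leEord.
by rewrite [i <= _]leq_eqVlt (negPf ii0) orbF val_eqE (negPf nii0).
Qed.


(** * Ordered lists of blocks *)

Lemma enum_ord1 : enum 'I_1 = [:: ord0].
Proof. by rewrite enum_ordSl (size0nil (size_enum_ord 0)). Qed.

Lemma iota_flatten (F : nat -> nat) k :
  flatten [seq iota (\sum_(l < i) F l) (F i) | i <- iota 0 k]
  = iota 0 (\sum_(l < k) F l).
Proof.
elim: k => [|k IH]; first by rewrite big_ord0.
rewrite -addn1 iotaD map_cat flatten_cat IH /= cats0 addn1 big_ord_recr /=.
by rewrite iotaD.
Qed.

Lemma enum_flatten k (n : 'I_k -> nat) :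
  enum 'I_(\sum_i n i)
  = flatten [seq [seq tagnat.Rank i t | t <- enum 'I_(n i)] | i <- enum 'I_k].
Proof.
(* Extension of [n] by zero to all of [nat], so that [iota_flatten] and its partial sums apply. *)
pose F l := oapp n 0 (insub l).
have FE (i : 'I_k) : F i = n i by rewrite /F valK.
have sumF (i : nat) : i <= k -> \sum_(l < k | l < i) n l = \sum_(l < i) F l.
  move=> ik; rewrite (big_ord_widen k F ik).
  by apply: eq_bigr => l _; rewrite FE.
apply: (inj_map (@ord_inj _)); rewrite val_enum_ord map_flatten -map_comp.
under eq_map => i do rewrite /= -map_comp.
transitivity (iota 0 (\sum_(l < k) F l)).
  by congr iota; apply: eq_bigr => i _; rewrite FE.
rewrite -iota_flatten -val_enum_ord -map_comp; congr flatten; apply: eq_map => i /=.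
rewrite -sumF 1?ltnW // FE -[\sum_(_ < _ | _) _]addn0 iotaDl -val_enum_ord -map_comp.
by apply: eq_map => t; apply/esym; apply: tagnat.RankEsum.
Qed.

(** The entry [g i] is at position [s i]. *)
Definition lst k (s : 'S_k) T (g : 'I_k -> T) : seq T :=
  [seq g ((s^-1)%g j) | j <- enum 'I_k].

Lemma lst_mulr k (s a : 'S_k) T (g : 'I_k -> T) :
  lst (s * a)%g g = lst a (fun i => g ((s^-1)%g i)).
Proof. by apply: eq_map => j; rewrite invMg permM. Qed.

Lemma lst1 k T (g : 'I_k -> T) : lst 1%g g = [seq g j | j <- enum 'I_k].
Proof. by apply: eq_map => j; rewrite invg1 perm1. Qed.

Lemma map_lst k (s : 'S_k) T U (f : T -> U) (g : 'I_k -> T) :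
  map f (lst s g) = lst s (fun i => f (g i)).
Proof. by rewrite /lst -map_comp. Qed.

Lemma lst_eq k (s : 'S_k) T (g g' : 'I_k -> T) : g =1 g' -> lst s g = lst s g'.
Proof. by move=> e; apply: eq_map => j; rewrite e. Qed.

Lemma gammaE k (j : 'I_k -> nat) (a : 'S_k) (b : forall i, 'S_(j i)) i i' t
    (t' : 'I_(j ((a^-1)%g i'))) :
  a i = i' -> b i t = t' :> nat ->
  gamma a b (tagnat.Rank i t)
  = inj_cast (block_sum a j)
      (@tagnat.Rank _ (fun i => j ((a^-1)%g i)) i' t').
Proof.
move=> ai bt; rewrite permE !injection_compE inj_sumE; congr (inj_cast (block_sum a j) _).
by apply: blockE => //; rewrite inj_ofE.
Qed.

(** In terms of lists, operadic composition is substitution: each group is ordered by its [b i], and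
    the groups are ordered by [a]. All later uses of the formula for [gamma] go through this
    form. *)
Lemma lst_gamma k (j : 'I_k -> nat) (a : 'S_k) (b : forall i, 'S_(j i)) T
    (Y : forall i, 'I_(j i) -> T) :
  lst (gamma a b) (fun s => Y (tagnat.sig1 s) (tagnat.sig2 s))
  = flatten (lst a (fun i => lst (b i) (Y i))).
Proof.
rewrite {1}/lst.
have -> : enum 'I_(\sum_i j i)
    = map (inj_cast (block_sum a j)) (enum 'I_(\sum_i j ((a^-1)%g i))).
  apply: (inj_map (@ord_inj _)); rewrite -map_comp val_enum_ord.
  under eq_map => i do rewrite /= inj_castE.
  by rewrite val_enum_ord block_sum.
rewrite -map_comp enum_flatten map_flatten -map_comp; congr flatten.
apply: eq_map => i /=; rewrite -map_comp; apply: eq_map => t /=.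
have e : ((gamma a b)^-1)%g (inj_cast (block_sum a j) (tagnat.Rank i t))
    = tagnat.Rank ((a^-1)%g i) (((b ((a^-1)%g i))^-1)%g t).
  rewrite -[RHS](permK (gamma a b)).
  by congr (_ _); apply/esym/gammaE; rewrite ?permKV.
rewrite -[RHS](sig_Rank Y).
exact: (congr1 (fun s => Y (tagnat.sig1 s) (tagnat.sig2 s)) e).
Qed.

(** * Operations on arrows *)

(** The group element is forced by its endpoints: Sym(k) is the indiscrete category on Sigma_k, and
    an arrow of it is just a pair of orders. *)
Lemma sym_hom_irr k (a b : 'S_k) (f g : sym_hom a b) : f = g.
Proof.
apply: val_inj; apply: (mulgI a).
by rewrite (eqP (svalP f)) (eqP (svalP g)).
Qed.

Fact shift_subproof k (a b : 'S_k) : (a * (a^-1 * b))%g == b.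
Proof. by rewrite mulKVg. Qed.

Definition sym_shift k (a b : sym_cat k) : hom a b :=
  exist (fun x => (a * x)%g == b) _ (shift_subproof a b).

Lemma icat_amap1 (A : icategory) n (u : arr (A n)) :
  amap (icat_map A (injection_id n)) u = u.
Proof. by rewrite icat_map1 amap_id. Qed.

Lemma icat_amapM (A : icategory) l m n (g : injection m n) (f : injection l m)
    (u : arr (A l)) :
  amap (icat_map A (injection_comp g f)) u
  = amap (icat_map A g) (amap (icat_map A f) u).
Proof. by rewrite icat_mapM. Qed.

(** [Blk a f] stands for the arrow [icat_map A a f], with [a] and [f] remembered. *)
Record ablk (A : icategory) (n : nat) := Blk {
  bm : nat;
  bi : injection bm n;
  bf : arr (A bm) }.

Arguments Blk {A n bm} bi bf.

Definition push (A : icategory) m n (h : injection m n) (b : ablk A m) : ablk A n :=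
  Blk (injection_comp h (bi b)) (bf b).

Lemma push1 (A : icategory) n (b : ablk A n) : push (injection_id n) b = b.
Proof.
case: b => m a f; congr Blk.
by apply: injection_eq => i; rewrite injection_compE injection_idE.
Qed.

Lemma pushM (A : icategory) l m n (g : injection m n) (f : injection l m)
    (b : ablk A l) :
  push (injection_comp g f) b = push g (push f b).
Proof.
by congr Blk; apply: injection_eq => i; rewrite !injection_compE.
Qed.

Lemma amap_comp C D E (G : functor D E) (F : functor C D) (u : arr C) :
  amap (G \oF F) u = amap G (amap F u).
Proof. by []. Qed.

Section Operations.
Variables (A : icategory) (S : sym_structure A).

Definition arr_family k (n : 'I_k -> nat) (s t : 'S_k) (f : forall i, arr (A (n i))) :
    arr (prod_cat (sym_cat k) (pi_cat (fun i => A (n i)))) :=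
  @Arr (prod_cat (sym_cat k) (pi_cat (fun i => A (n i))))
    (s, fun i => asrc (f i)) (t, fun i => atgt (f i))
    (sym_shift s t, fun i => amor (f i)).

Definition opA k (n : 'I_k -> nat) (s t : 'S_k) (f : forall i, arr (A (n i))) :
    arr (A (\sum_i n i)) :=
  amap (sym_op S n) (arr_family s t f).

Lemma amap_sym_op k (n : 'I_k -> nat) x y
    (u : @hom (prod_cat (sym_cat k) (pi_cat (fun i => A (n i)))) x y) :
  amap (sym_op S n) (Arr u) = opA x.1 y.1 (fun i => Arr (u.2 i)).
Proof.
case: x y u => [s x] [t y] [h u] /=; rewrite /opA /arr_family.
by rewrite (sym_hom_irr h (sym_shift s t)).
Qed.

Lemma opA_id k (n : 'I_k -> nat) s (x : forall i, A (n i)) :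
  opA s s (fun i => aid (x i)) = aid (sym_op S n (s, x)).
Proof.
rewrite /opA /arr_family (sym_hom_irr (sym_shift s s) (@idm (sym_cat k) s)).
by rewrite -(amap_aid (sym_op S n)).
Qed.

Lemma opA_nat k (m n : 'I_k -> nat) (h : forall i, injection (m i) (n i)) s t
    (f : forall i, arr (A (m i))) :
  amap (icat_map A (inj_sum h)) (opA s t f)
  = opA s t (fun i => amap (icat_map A (h i)) (f i)).
Proof. exact: (congr1 (fun H => amap H _) (sym_nat S h)). Qed.

Lemma opA_equiv k (r : 'S_k) (n : 'I_k -> nat) a b (f : forall i, arr (A (n i))) :
  amap (icat_map A (block r n)) (opA (r * a)%g (r * b)%g f)
  = opA a b (fun i => f ((r^-1)%g i)).
Proof.
have e := congr1 (fun H => amap H (arr_family a b f)) (sym_equiv S r n).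
by rewrite !amap_comp [X in amap _ X = _]amap_sym_op [RHS]amap_sym_op in e.
Qed.

Lemma opA_unit n (f : arr (A n)) :
  amap (icat_map A (inj_cast (sum_ord1 n))) (opA (n := fun=> n) 1%g 1%g (fun=> f)) = f.
Proof.
have e := congr1 (fun H => amap H f) (sym_unit S n).
by rewrite !amap_comp amap_id [X in amap _ X]amap_sym_op in e.
Qed.

Lemma opA_assoc k (j : 'I_k -> nat) (n : forall i, 'I_(j i) -> nat)
    (a b : 'S_k) (c d : forall i, 'S_(j i)) (f : forall i t, arr (A (n i t))) :
  amap (icat_map A (inj_cast (flatten_sum n)))
    (opA a b (fun i => opA (c i) (d i) (f i)))
  = opA (n := fun s => n (tagnat.sig1 s) (tagnat.sig2 s))
      (gamma a c) (gamma b d) (fun s => f (tagnat.sig1 s) (tagnat.sig2 s)).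
Proof.
pose C := prod_cat (sym_cat k) (pi_cat (fun i =>
  prod_cat (sym_cat (j i)) (pi_cat (fun t => A (n i t))))).
pose u : arr C := @Arr C
  (a, fun i => (c i, fun t => asrc (f i t))) (b, fun i => (d i, fun t => atgt (f i t)))
  (sym_shift a b, fun i => (sym_shift (c i) (d i), fun t => amor (f i t))).
have e := congr1 (fun H => amap H u) (sym_assoc S n).
by rewrite !amap_comp [X in amap _ X = _]amap_sym_op [RHS]amap_sym_op in e.
Qed.

End Operations.

Lemma injection_compA l m n p (h : injection n p) (g : injection m n)
    (f : injection l m) :
  injection_comp h (injection_comp g f) = injection_comp (injection_comp h g) f.
Proof. exact: (@compA inj_cat). Qed.

Lemma injection_sum2_eq k (j : 'I_k -> nat) (m : forall i, 'I_(j i) -> nat) n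
    (f g : injection (\sum_i \sum_t m i t) n) :
  (forall s : 'I_(\sum_i j i),
     injection_comp f
       (injection_comp (incl (fun i => \sum_t m i t) (tagnat.sig1 s))
          (incl (m (tagnat.sig1 s)) (tagnat.sig2 s)))
     = injection_comp g
       (injection_comp (incl (fun i => \sum_t m i t) (tagnat.sig1 s))
          (incl (m (tagnat.sig1 s)) (tagnat.sig2 s)))) ->
  f = g.
Proof.
move=> e; apply: injection_sum_eq => i v; rewrite -(tagnat.sig2K v).
move: (tagnat.sig1 v) (tagnat.sig2 v) => t w.
have := e (tagnat.Rank i t).
rewrite (sig_Rank (fun i t => injection_comp f
  (injection_comp (incl (fun i => \sum_t m i t) i) (incl (m i) t))
  = injection_comp g
  (injection_comp (incl (fun i => \sum_t m i t) i) (incl (m i) t)))).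
by move=> /(congr1 (fun h : injection _ _ => h w)); rewrite !injection_compE !inclE.
Qed.

(** * Evaluation of ordered lists of blocks *)

Section Evaluation.
Variables (A : icategory) (S : sym_structure A).

Section OpB.
Variables (n k : nat) (g : 'I_k -> ablk A n).
Hypothesis d : disj (fun i => bi (g i)).

(** When all blocks carry identities, this is the symmetry isomorphism from the product in the order
    [s] to the product in the order [t]. *)
Definition opB (s t : 'S_k) : arr (A n) :=
  amap (icat_map A (glue d)) (opA S s t (fun i => bf (g i))).

End OpB.

Lemma opB_eq n k (g g' : 'I_k -> ablk A n) (d : disj (fun i => bi (g i)))
    (d' : disj (fun i => bi (g' i))) s t :
  g =1 g' -> opB d s t = opB d' s t.
Proof.
by move=> /funext e; case: g' / e d' => d'; rewrite (Prop_irrelevance d d').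
Qed.

(** Together with [lst_mulr]: renumbering the blocks changes neither the source and target lists nor
    the value, so the numbering may be normalized. *)
Lemma opB_perm n k (g : 'I_k -> ablk A n) (d : disj (fun i => bi (g i)))
    (r a b : 'S_k) (d' : disj (fun i => bi (g ((r^-1)%g i)))) :
  opB d (r * a)%g (r * b)%g = opB d' a b.
Proof.
rewrite /opB -(glue_block (a := fun i => bi (g i)) d d') icat_amapM.
by rewrite (opA_equiv S r _ _ (fun i => bf (g i))).
Qed.

Lemma opB_push n n' (h : injection n n') k (g : 'I_k -> ablk A n)
    (d : disj (fun i => bi (g i))) (d' : disj (fun i => bi (push h (g i)))) s t :
  opB d' s t = amap (icat_map A h) (opB d s t).
Proof.
rewrite /opB -icat_amapM; congr (amap (icat_map A _) _).
by apply/esym/glue_eq => i u; rewrite !injection_compE glueE.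
Qed.

Section Flatten.
Variables (n k : nat) (g : 'I_k -> ablk A n) (d : disj (fun i => bi (g i))).
Variables (j : 'I_k -> nat) (h : forall i, 'I_(j i) -> ablk A (bm (g i))).
Hypothesis dh : forall i, disj (fun t => bi (h t : ablk A (bm (g i)))).

Definition flat (s : 'I_(\sum_i j i)) : ablk A n :=
  push (bi (g (tagnat.sig1 s))) (h (tagnat.sig2 s)).

Lemma disj_flat : disj (fun s => bi (flat s)).
Proof.
move=> s s'; rewrite /flat /= => t u; rewrite !injection_compE => e.
rewrite -(tagnat.sig2K s) -(tagnat.sig2K s').
have e1 := d e; move: (tagnat.sig1 s) (tagnat.sig1 s') (tagnat.sig2 s)
  (tagnat.sig2 s') e1 t u e => i i' v v' e1; case: i' / e1 v' => v' t u.
by move=> /injection_inj/dh ->.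
Qed.

Lemma opB_flat (a b : 'S_k) (c e : forall i, 'S_(j i)) :
  (forall i, bf (g i) = opB (@dh i) (c i) (e i)) ->
  opB d a b = opB disj_flat (gamma a c) (gamma b e).
Proof.
move=> ge; rewrite /opB.
have -> : (fun i => bf (g i)) = (fun i => opB (@dh i) (c i) (e i)).
  exact: functional_extensionality_dep.
rewrite /opB -(opA_nat S (fun i => glue (@dh i))) -icat_amapM.
have := opA_assoc S a b c e (fun i t => bf (h t : ablk A (bm (g i)))).
move=> /(congr1 (amap (icat_map A (glue disj_flat)))) <-.
rewrite -icat_amapM; congr (amap (icat_map A _) _).
apply: injection_sum2_eq => s; rewrite -!injection_compA flatten_incl.
rewrite [injection_comp (inj_sum _) _]injection_compA inj_sum_incl -injection_compA.
by rewrite glue_incl injection_compA !glue_incl.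
Qed.

End Flatten.

(** The data behind an arrow of A(n) built by one operation: disjoint blocks and
  the orders in which they are multiplied in the source and in the target. *)
Record gdata (n : nat) := GData {
  gk : nat;
  gb : 'I_gk -> ablk A n;
  gd : disj (fun i => bi (gb i));
  gs : 'S_gk;
  gt : 'S_gk }.

Definition gval n (D : gdata n) : arr (A n) := opB (@gd _ D) (gs D) (gt D).

(** A relation and not a function of the lists: blocks of size zero may be repeated, and then [l]
    and [l'] do not determine the permutation between them. *)
Definition gev n (l l' : seq (ablk A n)) (u : arr (A n)) : Prop :=
  exists D : gdata n,
    [/\ lst (gs D) (@gb _ D) = l, lst (gt D) (@gb _ D) = l' & gval D = u].

Lemma gevI n k (g : 'I_k -> ablk A n) (d : disj (fun i => bi (g i))) s t :
  gev (lst s g) (lst t g) (opB d s t).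
Proof. by exists (GData d s t). Qed.

Lemma codom_inj T k k' (g : 'I_k -> T) (g' : 'I_k' -> T) :
  [seq g i | i <- enum 'I_k] = [seq g' i | i <- enum 'I_k'] ->
  exists e : k' = k, forall i, g' i = g (cast_ord e i).
Proof.
move=> E; have e : k' = k.
  by have /(congr1 size) := E; rewrite !size_map -!enumT !size_enum_ord.
exists e; case: k / e g E => g /eq_in_map E i; rewrite cast_ord_id E //.
exact: mem_enum.
Qed.

Lemma gevE n l l' (u : arr (A n)) : gev l l' u ->
  exists (k : nat) (g : 'I_k -> ablk A n) (d : disj (fun i => bi (g i))) (r : 'S_k),
    [/\ l = [seq g i | i <- enum 'I_k], l' = lst r g & u = opB d 1%g r].
Proof.
case=> -[k g d a b] [/= <- <- <-].
have d' : disj (fun i => bi (g ((a^-1)%g i))) := disj_perm d (a^-1)%g.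
exists k, (fun i => g ((a^-1)%g i)), d', (a^-1 * b)%g; split.
- by [].
- by rewrite -lst_mulr mulKVg.
- by rewrite -opB_perm mulKVg mulg1.
Qed.

(** A witness of [gev] comes with its own numbering of the blocks; it can be transported to any
    prescribed numbering [g] of the source list. *)
Lemma gevE_lst n k (g : 'I_k -> ablk A n) (a : 'S_k) l' (u : arr (A n)) :
  gev (lst a g) l' u ->
  exists (d : disj (fun i => bi (g i))) (r : 'S_k), l' = lst r g /\ u = opB d a r.
Proof.
case/gevE=> k' [g' [d [r [/codom_inj [e g'E] -> ->]]]].
case: k / e g a g'E => g a g'E.
have gE i : g i = g' (a i) by rewrite g'E cast_ord_id permK.
have {}g'E i : g' i = g ((a^-1)%g i) by rewrite g'E cast_ord_id.
have dg : disj (fun i => bi (g i)).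
  by move=> i j; rewrite !gE => t t' /d/perm_inj.
exists dg, (a * r)%g; split.
  by rewrite lst_mulr; apply: lst_eq.
have d' : disj (fun i => bi (g ((a^-1)%g i))) := disj_perm dg (a^-1)%g.
by rewrite -{1}[a]mulg1 (opB_perm _ _ _ d'); apply: opB_eq.
Qed.

Lemma gev_push m n (h : injection m n) l l' (u : arr (A m)) :
  gev l l' u -> gev (map (push h) l) (map (push h) l') (amap (icat_map A h) u).
Proof.
case=> -[k g d a b] [/= <- <- <-]; rewrite !map_lst.
by exists (GData (disj_comp d h : disj (fun i => bi (push h (g i)))) a b); split=> //;
  apply: opB_push.
Qed.

Lemma gev_flatten n k (g : 'I_k -> ablk A n) (d : disj (fun i => bi (g i)))
    (l l' : forall i, seq (ablk A (bm (g i)))) a b :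
  (forall i, gev (l i) (l' i) (bf (g i))) ->
  gev (flatten (lst a (fun i => map (push (bi (g i))) (l i))))
      (flatten (lst b (fun i => map (push (bi (g i))) (l' i))))
      (opB d a b).
Proof.
move=> H; pose D i := sval (cid (H i)).
have DE i : [/\ lst (gs (D i)) (@gb _ (D i)) = l i, lst (gt (D i)) (@gb _ (D i)) = l' i
              & gval (D i) = bf (g i)] := svalP (cid (H i)).
pose F i t := push (bi (g i)) (@gb _ (D i) t).
rewrite (@opB_flat n k g d _ _ (fun i => @gd _ (D i)) a b (fun i => gs (D i))
   (fun i => gt (D i))); last by move=> i; case: (DE i).
(* Source and target lists are flattened by one argument, stated for arbitrary orders. *)
suff E (p : 'S_k) (c : forall i, 'S_(gk (D i))) l0 :
    (forall i, lst (c i) (@gb _ (D i)) = l0 i) ->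
    flatten (lst p (fun i => map (push (bi (g i))) (l0 i)))
    = lst (gamma p c) (flat (fun i => @gb _ (D i))).
  rewrite (E a (fun i => gs (D i))) => [|i]; last by case: (DE i).
  rewrite (E b (fun i => gt (D i))) => [|i]; last by case: (DE i).
  exact: gevI.
move=> cE; rewrite (lst_gamma p c F); congr flatten; apply: lst_eq => i.
by rewrite -cE map_lst.
Qed.

Lemma gev1 n (u : arr (A n)) :
  gev [:: Blk (injection_id n) u] [:: Blk (injection_id n) u] u.
Proof.
pose g (i : 'I_1) := Blk (injection_id n) u.
have d : disj (fun i => bi (g i)) by move=> i j t t' _; rewrite !ord1.
have := gevI d 1%g 1%g; rewrite lst1 enum_ord1 /=.
suff -> : opB d 1%g 1%g = u by [].
rewrite -[RHS](opA_unit S) /opB; congr (amap (icat_map A _) _).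
apply/esym/glue_eq => i t; apply: ord_inj.
rewrite inj_castE injection_idE tagnat.RankEsum big1 // => j.
by rewrite !ord1 ltnn.
Qed.

End Evaluation.

(** * Presented objects *)

Lemma all_flatten T (p : pred T) (ss : seq (seq T)) : all p (flatten ss) = all (all p) ss.
Proof. by elim: ss => //= s ss IH; rewrite all_cat IH. Qed.

Lemma flatten_flatten T (ss : seq (seq (seq T))) :
  flatten (flatten ss) = flatten (map flatten ss).
Proof. by elim: ss => //= s ss IH; rewrite flatten_cat IH. Qed.

Section Words.
Variable A : sym_algebra.
Let S := sym_str A.

(** The size is positive so that disjoint blocks are distinct; the block carries an
  object, encoded as its identity. *)
Definition good n (b : ablk A n) : Prop := 0 < bm b /\ exists x, bf b = aid x.

Definition goods n (l : seq (ablk A n)) : bool := all (fun b => `[<good b>]) l.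

Lemma goods_push m n (f : injection m n) l : goods l -> goods (map (push f) l).
Proof. by rewrite /goods all_map; apply: sub_all. Qed.

Lemma goods_lst n k (s : 'S_k) (g : 'I_k -> ablk A n) :
  goods (lst s g) <-> forall i, good (g i).
Proof.
rewrite /goods all_map; split=> [/allP H i|H].
  by have /= := H (s i) (mem_enum _ _); rewrite permK => /asboolP.
by apply/allP => i _; apply/asboolP.
Qed.

Definition lop k (n : 'I_k -> nat) (s : 'S_k) (l : forall i, seq (ablk A (n i))) :
    seq (ablk A (\sum_i n i)) :=
  flatten (lst s (fun i => map (push (incl n i)) (l i))).

Lemma goods_lop k (n : 'I_k -> nat) s (l : forall i, seq (ablk A (n i))) :
  (forall i, goods (l i)) -> goods (lop s l).
Proof.
move=> H; rewrite /goods all_flatten all_map; apply/allP => i _ /=.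
exact: goods_push.
Qed.

Lemma gev_op k (n : 'I_k -> nat) (l l' : forall i, seq (ablk A (n i))) a b
    (f : forall i, arr (A (n i))) :
  (forall i, gev S (l i) (l' i) (f i)) ->
  gev S (lop a l) (lop b l') (opA S a b f).
Proof.
move=> H; pose g i : ablk A (\sum_i n i) := Blk (incl n i) (f i).
have := @gev_flatten A S _ k g (@disj_incl k n) l l' a b H.
by rewrite /opB glue_inclE icat_amap1.
Qed.

(** That [value] is the product of the letters in their order is expressed by evaluating to an
    identity arrow, so that objects and morphisms obey the same calculus. *)
Record word n : Type := Word {
  letters : seq (ablk A n);
  value : A n;
  wordP : goods letters /\ gev S letters letters (aid value) }.

Definition words n : category := pull (@value n).

Lemma word_eq n (w w' : word n) :
  letters w = letters w' -> value w = value w' -> w = w'.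
Proof.
case: w w' => [l a p] [l' a' p'] /= el ea.
by case: l' / el p' => p'; case: a' / ea p' => p'; congr Word.
Qed.

(** Splits every law for [words] into the same law in A, which is known, and an equality of lists of
    letters. *)
Lemma words_functor C n (F G : functor C (words n)) :
  (forall x, letters (F x) = letters (G x)) ->
  (forall u, amap (pullF (@value n)) (amap F u) = amap (pullF (@value n)) (amap G u)) ->
  F = G.
Proof.
move=> el e; apply: pull_functor; last exact: functor_arr.
by move=> x; apply: word_eq => //; have /(congr1 (@asrc _)) := e (aid x).
Qed.

Fact words_map_subproof m n (f : injection m n) (w : word m) :
  goods (map (push f) (letters w)) /\
  gev S (map (push f) (letters w)) (map (push f) (letters w))
    (aid (icat_map A f (value w))).
Proof.
case: w => [l a [/= gl el]]; split; first exact: goods_push.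
by rewrite -amap_aid; apply: (gev_push f el).
Qed.

Definition words_map m n (f : injection m n) : functor (words m) (words n).
Proof.
exists (fun w => Word (words_map_subproof f w) : words n)
  (fun x y u => fmap (icat_map A f) u).
- by move=> x; apply: fmap1.
- by move=> *; apply: fmapM.
Defined.

Definition words_icat : icategory.
Proof.
exists words words_map.
- move=> n; apply: words_functor => [w|[x y u]] /=; last exact: (icat_amap1 (Arr _)).
  by rewrite -[RHS]map_id; apply: eq_map => b; apply: push1.
- move=> l m n g f; apply: words_functor => [w|[x y u]] /=.
    by rewrite -map_comp; apply: eq_map => b; apply: pushM.
  exact: (icat_amapM _ _ (Arr _)).
Defined.

Fact words_op_subproof k (n : 'I_k -> nat) (s : 'S_k) (w : forall i, word (n i)) :
  let l := lop s (fun i => letters (w i)) in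
  goods l /\ gev S l l (aid (sym_op S n (s, fun i => value (w i)))).
Proof.
split; first by apply: goods_lop => i; case: (wordP (w i)).
rewrite -amap_aid amap_sym_op.
by apply: gev_op => i; case: (wordP (w i)).
Qed.

Definition value_family k (n : 'I_k -> nat) :
    functor (prod_cat (sym_cat k) (pi_cat (fun i => words_icat (n i))))
            (prod_cat (sym_cat k) (pi_cat (fun i => A (n i)))) :=
  fprod (fid _) (fpi (fun i => pullF (@value (n i)))).

Definition words_op k (n : 'I_k -> nat) :
  functor (prod_cat (sym_cat k) (pi_cat (fun i => words_icat (n i))))
          (words_icat (\sum_i n i)).
Proof.
exists (fun x => Word (words_op_subproof x.1 x.2) : words _)
  (fun x y u => fmap (sym_op S n \oF value_family n) u).
- by move=> x; apply: (fmap1 (sym_op S n \oF value_family n)).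
- by move=> *; apply: (fmapM (sym_op S n \oF value_family n)).
Defined.

Lemma lop_push k (m n : 'I_k -> nat) (f : forall i, injection (m i) (n i)) s
    (l : forall i, seq (ablk A (m i))) :
  map (push (inj_sum f)) (lop s l) = lop s (fun i => map (push (f i)) (l i)).
Proof.
rewrite /lop map_flatten map_lst; congr flatten; apply: lst_eq => i.
rewrite -!map_comp; apply: eq_map => b /=.
by rewrite -!pushM inj_sum_incl.
Qed.

Lemma lop_block k (r s : 'S_k) (n : 'I_k -> nat) (l : forall i, seq (ablk A (n i))) :
  map (push (block r n)) (lop (r * s)%g l)
  = lop s (fun i => l ((r^-1)%g i)).
Proof.
rewrite /lop map_flatten map_lst lst_mulr; congr flatten; apply: lst_eq => i.
by rewrite -map_comp; apply: eq_map => b /=; rewrite -pushM block_incl.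
Qed.

Lemma lop_unit n (l : seq (ablk A n)) :
  map (push (inj_cast (sum_ord1 n))) (lop (n := fun=> n) (1%g : 'S_1) (fun=> l)) = l.
Proof.
rewrite /lop lst1 enum_ord1 /= cats0.
rewrite -map_comp -[RHS]map_id; apply: eq_map => b /=.
rewrite -pushM -[RHS]push1; congr (push _ _).
apply: injection_eq => t; apply: ord_inj.
rewrite injection_compE injection_idE inj_castE inclE tagnat.RankEsum.
by rewrite big1 // => i; rewrite ltn0.
Qed.

(** Associativity of nested flattening: [lst_gamma] accounts for the order of the letters and
    [flatten_incl] for their positions. *)
Lemma lop_flatten k (j : 'I_k -> nat) (n : forall i, 'I_(j i) -> nat)
    (a : 'S_k) (b : forall i, 'S_(j i)) (l : forall i t, seq (ablk A (n i t))) :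
  map (push (inj_cast (flatten_sum n)))
    (lop a (fun i => lop (b i) (l i)))
  = lop (n := fun s => n (tagnat.sig1 s) (tagnat.sig2 s))
      (gamma a b) (fun s => l (tagnat.sig1 s) (tagnat.sig2 s)).
Proof.
pose Y i t := map (push (injection_comp (inj_cast (flatten_sum n))
  (injection_comp (incl (fun i => \sum_t n i t) i) (incl (n i) t)))) (l i t).
rewrite [RHS]/lop (lst_eq _ (g' := fun s => Y (tagnat.sig1 s) (tagnat.sig2 s))).
  rewrite lst_gamma flatten_flatten map_lst /lop map_flatten map_lst.
  congr flatten; apply: lst_eq => i; rewrite -map_comp map_flatten map_lst.
  congr flatten; apply: lst_eq => t; rewrite -map_comp; apply: eq_map => c /=.
  by rewrite !pushM.
by move=> s; rewrite /Y flatten_incl.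
Qed.

Definition words_sym_structure : sym_structure words_icat.
Proof.
exists words_op.
- move=> k m n f; apply: words_functor => [x|u]; first exact: lop_push.
  exact: (congr1 (fun H => amap H (amap (@value_family k m) u)) (sym_nat S f)).
- move=> k r n; apply: words_functor => [x|u]; first exact: lop_block.
  exact: (congr1 (fun H => amap H (amap (@value_family k n) u)) (sym_equiv S r n)).
- move=> n; apply: words_functor => [x|u]; first exact: lop_unit.
  exact: (congr1 (fun H => amap H (amap (pullF (@value n)) u)) (sym_unit S n)).
- move=> k j n; apply: words_functor => [x|u]; first exact: lop_flatten.
  exact: (congr1 (fun H => amap H (amap
    (fprod (fid _) (fpi (fun i => value_family (n i)))) u)) (sym_assoc S n)).
Defined.

Definition words_algebra : sym_algebra := SymAlgebra words_sym_structure.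

Definition words_value : imap words_algebra A.
Proof.
exists (fun n => pullF (@value n)) => m n f.
exact: functor_arr.
Defined.

Lemma words_value_sym : @sym_morphism words_algebra A words_value.
Proof.
by move=> k n; apply: functor_arr => -[x y u]; rewrite /amap /=.
Qed.

End Words.

(** * Reordering isomorphisms *)

Section Coherence.
Variable A : sym_algebra.
Let S := sym_str A.

Lemma lst_perm_inj T k (g : 'I_k -> T) (r r' : 'S_k) :
  injective g -> lst r g = lst r' g -> r = r'.
Proof.
move=> gI /eq_in_map e; apply: invg_inj; apply/permP => i.
by apply/gI/e/mem_enum.
Qed.

(** The blocks being fixed objects, the product is a functor of their order. *)
Lemma opB_good n k (g : 'I_k -> ablk A n) (d : disj (fun i => bi (g i))) :
  (forall i, good (g i)) ->
  exists F : functor (sym_cat k) (A n),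
    forall s t, opB S d s t = Arr (fmap F (sym_shift s t)).
Proof.
move=> gg; pose x i := sval (cid (proj2 (gg i))).
have bx : (fun i => bf (g i)) = (fun i => aid (x i)).
  by apply: functional_extensionality_dep => i; exact: (svalP (cid (proj2 (gg i)))).
exists (icat_map A (glue d) \oF sym_op S (fun i => bm (g i))
  \oF fpair (fid (sym_cat k)) (fconst (x : pi_cat (fun i => A (bm (g i)))))).
by move=> s t; rewrite /opB bx.
Qed.

(** Letters are identity arrows, so an arrow evaluated from them is a pure symmetry isomorphism. *)
Definition reorder n (w w' : words A n) (f : hom w w') : Prop :=
  gev S (letters w) (letters w') (@Arr (A n) (value w) (value w') f).

Lemma reorder_id n (w : words A n) : reorder (idm w).
Proof. by case: (wordP w). Qed.

(** With an injective numbering [g] of the letters fixed, all their reorderings are images of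
    morphisms of Sym(k) under a single functor [F]. Uniqueness, composites and inverses are thereby
    inherited from the indiscrete category Sym(k). *)
Lemma reorderE n (w w' : words A n) (f : hom w w') : reorder f ->
  exists k (g : 'I_k -> ablk A n) (r : 'S_k) (F : functor (sym_cat k) (A n)),
  [/\ injective g, letters w = lst 1%g g, letters w' = lst r g,
      @Arr (A n) (value w) (value w') f = Arr (fmap F (sym_shift 1%g r))
    & forall a l u, gev S (lst a g) l u
        <-> exists t, l = lst t g /\ u = Arr (fmap F (sym_shift a t))].
Proof.
case/gevE=> k [g [d [r [lw lw' fE]]]].
have gg : forall i, good (g i).
  by apply/(goods_lst 1%g); rewrite lst1 -lw; case: (wordP w).
have [F FE] := opB_good d gg.
exists k, g, r, F; split=> //.
(* Equal letters at [i] and [j] would share the image of the point 0 of their nonempty block, which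
   disjointness allows only for i = j. *)
- move=> i j gij; have [m0 _] := gg i.
  apply: (d i j (Ordinal m0) (cast_ord (congr1 (@bm _ _) gij) (Ordinal m0))).
  by move: (g i) (g j) gij m0 => b c e; case: c / e => m0; rewrite cast_ord_id.
- by rewrite lst1.
- by rewrite fE FE.
- move=> a l u; split=> [/gevE_lst [d' [t [-> ->]]]|[t [-> ->]]].
    by exists t; split=> //; rewrite (Prop_irrelevance d' d) FE.
  by rewrite -FE; apply: gevI.
Qed.

(** The letters being distinct, the target list determines the permutation. *)
Lemma reorder_thin n (w w' : words A n) (f f' : hom w w') :
  reorder f -> reorder f' -> f = f'.
Proof.
move=> /reorderE [k [g [r [F [gI lw lw' fE FE]]]]].
rewrite /reorder lw lw' => /FE [t [/(lst_perm_inj gI) <-]].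
by rewrite -fE => /Arr_inj.
Qed.

Lemma reorder_comp n (w w' w'' : words A n) (f' : hom w' w'') (f : hom w w') :
  reorder f -> reorder f' -> reorder (f' \oc f).
Proof.
move=> /reorderE [k [g [r [F [gI lw lw' fE FE]]]]].
rewrite /reorder lw lw' => /FE [t [lw'' f'E]]; apply/FE; exists t; split=> //.
rewrite [LHS](Arr_comp f'E fE) -fmapM; congr (Arr (fmap F _)).
exact: sym_hom_irr.
Qed.

Lemma reorder_inv n (w w' : words A n) (f : hom w w') :
  reorder f -> exists f' : hom w' w, reorder f'.
Proof.
move=> /reorderE [k [g [r [F [gI lw lw' fE FE]]]]].
have e : value w = F (1%g : 'S_k) := congr1 (@asrc _) fE.
have e' : value w' = F r := congr1 (@atgt _) fE.
exists (idto (esym e) \oc fmap F (sym_shift r 1%g) \oc idto e').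
rewrite /reorder Arr_idtor Arr_idtol lw lw'; apply/FE.
by exists 1%g.
Qed.

Lemma reorder_map m n (h : injection m n) (w w' : words A m) (f : hom w w') :
  reorder f -> reorder (fmap (words_map A h) f).
Proof. exact: gev_push. Qed.

Lemma reorder_op k (n : 'I_k -> nat)
    (x y : prod_cat (sym_cat k) (pi_cat (fun i => words_algebra A (n i)))) (u : hom x y) :
  (forall i, reorder (u.2 i)) -> reorder (fmap (words_op A n) u).
Proof.
move=> H; rewrite /reorder -[X in gev _ _ _ X]/(amap (sym_op S n) (Arr _)).
by rewrite amap_sym_op; apply: gev_op.
Qed.

End Coherence.

(** * Weak equivalences *)

Lemma smap_eq X Y (f g : smap X Y) : (forall n x, f n x = g n x) -> f = g.
Proof.
case: f g => [f p] [g q] /= e.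
have fg : f = g by do 2!apply: functional_extensionality_dep => ?.
by case: g / fg q {e} => q; congr SMap.
Qed.

Lemma homotopic_comp X Y Z (f g : smap X Y) (h : smap Y Z) :
  homotopic f g -> homotopic (smap_comp h f) (smap_comp h g).
Proof.
elim=> {f g} [f g [H HE]|f|f g _|f g k _ fg _ gk].
- apply: rst_step; exists (smap_comp h H) => n x /=.
  by case: (HE n x) => -> ->.
- exact: rst_refl.
- exact: rst_sym.
- exact: rst_trans fg gk.
Qed.

Definition sprodl X Y Z (h : smap X Y) : smap (sprod X Z) (sprod Y Z).
Proof.
exists (fun n x => (h n x.1, x.2)) => m n f x /=.
by rewrite smap_nat.
Defined.

Lemma homotopic_precomp X Y Z (f g : smap Y Z) (h : smap X Y) :
  homotopic f g -> homotopic (smap_comp f h) (smap_comp g h).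
Proof.
elim=> {f g} [f g [H HE]|f|f g _|f g k _ fg _ gk].
- apply: rst_step; exists (smap_comp H (sprodl (simplex 1) h)) => n x /=.
  exact: HE.
- exact: rst_refl.
- exact: rst_sym.
- exact: rst_trans fg gk.
Qed.

Section NaturalTransformation.
Variables (C D : category) (F G : functor C D) (t : forall x, hom (F x) (G x)).
Hypothesis tN : forall x y (f : hom x y), fmap G f \oc t x = t y \oc fmap F f.

(** The natural transformation as a functor on C x {0 < 1}. The second coordinate is read as a
    natural number so that matching on it reduces. *)
Let cyl_ob (b : nat) (x : C) : D := if b is 0 then F x else G x.

Let cyl_hom (b b' : nat) (x y : C) (f : hom x y) :
    b <= b' -> hom (cyl_ob b x) (cyl_ob b' y) :=
  match b, b' return b <= b' -> hom (cyl_ob b x) (cyl_ob b' y) with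
  | 0, 0 => fun=> fmap F f
  | 0, _.+1 => fun=> fmap G f \oc t x
  | _.+1, _.+1 => fun=> fmap G f
  | _.+1, 0 => fun h => False_rect _ (notF h)
  end.

Lemma cyl_homM (b c d : nat) x y z (g : hom y z) (f : hom x y)
    (bc : b <= c) (cd : c <= d) (bd : b <= d) :
  cyl_hom (g \oc f) bd = cyl_hom g cd \oc cyl_hom f bc.
Proof.
case: b c d bc cd bd => [|b] [|c] [|d] //= _ _ _; rewrite fmapM //.
  by rewrite -compA tN compA.
by rewrite compA.
Qed.

Definition cylinder : functor (prod_cat C (ord_cat 1)) D.
Proof.
exists (fun x : prod_cat C (ord_cat 1) => cyl_ob (nat_of_ord x.2) x.1)
  (fun x y f => cyl_hom f.1 (f.2 : nat_of_ord x.2 <= nat_of_ord y.2)).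
- by case=> x [[|b] bP]; rewrite /= fmap1.
- by move=> *; apply: cyl_homM.
Defined.

Lemma nerve_homotopy : homotopy (nerve_map F) (nerve_map G).
Proof.
unshelve eexists.
  exists (fun n (x : functor (ord_cat n) C * monotone n 1) =>
            cylinder \oF fpair x.1 (ord_functor x.2)) => m n f [x u] /=.
  have -> : ord_functor (mono_comp u f) = ord_functor u \oF ord_functor f.
    by apply: ord_functor_eq => i; apply: mono_compE.
  exact: functor_irr.
have cst n (c : 'I_2) : ord_functor (mono_const n c) = @fconst (ord_cat n) (ord_cat 1) c.
  by apply: ord_functor_eq => i; rewrite /= mono_ofE.
by move=> n x; rewrite /= !cst; split; apply: functor_arr => -[i j f].
Qed.

End NaturalTransformation.

Lemma nerve_map_comp C D E (G : functor D E) (F : functor C D) :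
  nerve_map (G \oF F) = smap_comp (nerve_map G) (nerve_map F).
Proof. by apply: smap_eq => n x; rewrite /= fcompA. Qed.

Lemma smap_comp_nerve_id C Z (f : smap (nerve C) Z) : smap_comp f (nerve_map (fid C)) = f.
Proof. by apply: smap_eq => n x; rewrite /= fcomp1f. Qed.

Lemma smap_compA X Y Z W (h : smap Z W) (g : smap Y Z) (f : smap X Y) :
  smap_comp h (smap_comp g f) = smap_comp (smap_comp h g) f.
Proof. exact: smap_eq. Qed.

(** On homotopy classes of maps into [Z], precomposition with [G] is inverse to precomposition with
    [F]. *)
Lemma homotopy_weak_equivalence C D (F : functor C D) (G : functor D C) :
  homotopic (nerve_map (fid C)) (nerve_map (G \oF F)) ->
  homotopic (nerve_map (fid D)) (nerve_map (F \oF G)) ->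
  weak_equivalence F.
Proof.
move=> GF FG Z _; split=> [g g' gg'|h].
- have E (k : smap (nerve D) Z) : homotopic k (smap_comp k (nerve_map (F \oF G))).
    by rewrite -{1}[k]smap_comp_nerve_id; apply: homotopic_comp.
  apply: rst_trans (E g) _; apply: rst_trans (rst_sym _ _ _ _ (E g')).
  by rewrite nerve_map_comp !smap_compA; apply: homotopic_precomp.
- exists (smap_comp h (nerve_map G)); rewrite -smap_compA -nerve_map_comp.
  by apply: rst_sym; rewrite -{1}[h]smap_comp_nerve_id; apply: homotopic_comp.
Qed.

(** [G] is determined by its objects [o], [F] being fully faithful, and the natural
  transformation from the identity to [H] is that from the identity to [F \oF G];
  it lifts along [F]. *)
Lemma ff_weak_equivalence C D (F : functor C D) (o : D -> C) (H : functor D D)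
    (eta : forall d, hom d (H d)) :
  (forall x y (f g : hom x y), fmap F f = fmap F g -> f = g) ->
  (forall x y (h : hom (F x) (F y)), exists f, fmap F f = h) ->
  (forall d, F (o d) = H d) ->
  (forall x y (f : hom x y), fmap H f \oc eta x = eta y \oc f) ->
  weak_equivalence F.
Proof.
move=> Finj Fsurj oE etaN.
pose lift x y (h : hom (F x) (F y)) := sval (cid (Fsurj x y h)).
have liftE x y (h : hom (F x) (F y)) : fmap F (lift x y h) = h := svalP (cid (Fsurj x y h)).
pose Gm x y (f : hom x y) : hom (o x) (o y) :=
  lift _ _ (idto (esym (oE y)) \oc fmap H f \oc idto (oE x)).
have GmE x y (f : hom x y) :
    fmap F (Gm x y f) = idto (esym (oE y)) \oc fmap H f \oc idto (oE x) := liftE _ _ _.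
have canc x y (g : hom x (H y)) : idto (oE y) \oc (idto (esym (oE y)) \oc g) = g.
  by rewrite compA idtoM idto_id comp1m.
have @G : functor D C.
  exists o Gm => [x|x y z g f]; apply: Finj; rewrite GmE.
    by rewrite !fmap1 compm1 idtoM idto_id.
  by rewrite !fmapM !GmE -!compA canc.
have GE x y (f : hom x y) : idto (oE y) \oc fmap (F \oF G) f = fmap H f \oc idto (oE x).
  by rewrite /= GmE -!compA canc.
pose t d : hom d ((F \oF G) d) := idto (esym (oE d)) \oc eta d.
have tN x y (f : hom x y) : fmap (F \oF G) f \oc t x = t y \oc f.
  rewrite /t /= GmE -!compA; congr (_ \oc _); rewrite -etaN; congr (_ \oc _).
  by rewrite compA idtoM idto_id comp1m.
apply: (@homotopy_weak_equivalence _ _ F G); apply: rst_step; last first.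
  by apply: (@nerve_homotopy _ _ (fid D) (F \oF G) t).
apply: (@nerve_homotopy _ _ (fid C) (G \oF F) (fun x => lift _ _ (t (F x)))).
move=> x y f; apply: (Finj); rewrite !fmapM (liftE _ _ (t (F x))) (liftE _ _ (t (F y))).
exact: tN.
Qed.

Section GrothendieckFunctor.
Variables (X Y : icategory) (F : imap X Y).

Lemma groth_hom_arr (Z : icategory) (p q : groth Z) (f g : hom p q) :
  tag f = tag g -> Arr (tagged f) = Arr (tagged g) -> f = g.
Proof.
case: f g => [a s] [b t] /= e; case: b / e t => t /Arr_inj ->.
by [].
Qed.

Lemma groth_map_inj :
  (forall n (x y : X n) (f g : hom x y), fmap (F n) f = fmap (F n) g -> f = g) ->
  forall (p q : groth X) (f g : hom p q),
    fmap (groth_map F) f = fmap (groth_map F) g -> f = g.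
Proof.
move=> inj p q [a s] [b t] e.
have ab : a = b := congr1 (fun f : groth_hom _ _ => tag f) e.
case: b / ab t e => t e; congr (existT _ a _); apply: inj; apply: Arr_inj.
have := congr1 (fun f : groth_hom _ _ => Arr (tagged f)) e.
by rewrite /= !Arr_idtor.
Qed.

Lemma groth_map_surj :
  (forall n (x y : X n) (h : hom (F n x) (F n y)), exists f, fmap (F n) f = h) ->
  forall (p q : groth X) (h : hom (groth_map F p) (groth_map F q)),
    exists f, fmap (groth_map F) f = h.
Proof.
move=> surj [m x] [n y] [a s].
have [f fE] := surj n _ _ (s \oc idto (esym (imap_ob F a x))).
exists (existT _ a f : @hom (groth X) (existT _ m x) (existT _ n y)).
congr (existT _ a _); rewrite /= fE -compA idtoM idto_id.
exact: compm1.
Qed.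

End GrothendieckFunctor.

Section Shift.
Variable X : icategory.

(** The new point is put first because [1 + m] is convertible to [m.+1], the form of positive
    degrees in [shift_I_equivalence]. *)
Definition shift_map m n (a : injection m n) : injection (1 + m) (1 + n) :=
  inj_add (injection_id 1) a.

Lemma shift_nat m n (a : injection m n) :
  injection_comp (shift_map a) (rinj 1 m) = injection_comp (rinj 1 n) a.
Proof.
apply: injection_eq => i; rewrite !injection_compE !inj_ofE.
by rewrite (unsplitK (inr i)).
Qed.

Lemma shift_ob m n (a : injection m n) (x : X m) :
  icat_map X (shift_map a) (icat_map X (rinj 1 m) x)
  = icat_map X (rinj 1 n) (icat_map X a x).
Proof. by rewrite -!icat_obM shift_nat. Qed.

Definition shift_groth_ob (p : groth X) : groth X :=
  existT _ (1 + tag p) (icat_map X (rinj 1 (tag p)) (tagged p)).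

Definition shift_groth_hom (p q : groth X) (f : hom p q) :
    hom (shift_groth_ob p) (shift_groth_ob q) :=
  existT _ (shift_map (tag f))
    (fmap (icat_map X (rinj 1 (tag q))) (tagged f) \oc idto (shift_ob (tag f) (tagged p))).

Lemma shift_map1 n : shift_map (injection_id n) = injection_id (1 + n).
Proof.
apply: injection_eq => i; rewrite inj_ofE injection_idE.
by case: (splitP i) => j ij; apply: ord_inj; rewrite injection_idE /= ij.
Qed.

Lemma shift_mapM l m n (b : injection m n) (a : injection l m) :
  shift_map (injection_comp b a) = injection_comp (shift_map b) (shift_map a).
Proof.
apply: injection_eq => i; rewrite injection_compE !inj_ofE.
case: (splitP i) => j ij.
  by rewrite (unsplitK (inl _)) !injection_idE.
by rewrite (unsplitK (inr _)) injection_compE.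
Qed.

Definition shift : functor (groth X) (groth X).
Proof.
exists shift_groth_ob shift_groth_hom.
- case=> m x; apply: groth_hom_arr; first exact: shift_map1.
  rewrite /= Arr_idtor (fmap_idto _ (congr1 _ (icat_ob1 _))) !Arr_idto.
  by rewrite /aid !icat_ob1.
- move=> [l x] [m y] [n z] [b t] [a s]; apply: groth_hom_arr; first exact: shift_mapM.
  rewrite /= !fmapM !Arr_idtor (fmap_idto _ (congr1 _ (icat_obM _ _ _))) Arr_idtor.
  rewrite (fmap_idto _ (congr1 _ (shift_ob _ _))) compA Arr_idtor.
  apply: Arr_comp; first by rewrite Arr_idtor.
  have := icat_amapM (A := X) (shift_map b) (rinj 1 m) (Arr s).
  by rewrite shift_nat icat_amapM.
Defined.

Definition shift_unit (p : groth X) : hom p (shift p) :=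
  existT _ (rinj 1 (tag p)) (idm _).

Lemma shift_unit_nat (p q : groth X) (f : hom p q) :
  fmap shift f \oc shift_unit p = shift_unit q \oc f.
Proof.
case: p q f => [m x] [n y] [a s]; apply: groth_hom_arr; first exact: shift_nat.
by rewrite /= fmap1 compm1 comp1m !Arr_idtor.
Qed.

End Shift.

(** The functor [shift] moves every object to positive degree, and receives a natural
  transformation from the identity. *)
Lemma shift_I_equivalence X Y (F : imap X Y) (o : forall n, Y n.+1 -> X n.+1) :
  (forall n (x y : X n) (f g : hom x y), fmap (F n) f = fmap (F n) g -> f = g) ->
  (forall n (x y : X n) (h : hom (F n x) (F n y)), exists f, fmap (F n) f = h) ->
  (forall n (y : Y n.+1), F n.+1 (o n y) = y) ->
  I_equivalence F.
Proof.
move=> inj surj oE.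
pose o' (p : groth Y) : groth X :=
  existT _ (1 + tag p) (o (tag p) (icat_map Y (rinj 1 (tag p)) (tagged p))).
apply: (@ff_weak_equivalence _ _ (groth_map F) o' (shift Y) (@shift_unit Y)).
- exact: groth_map_inj.
- exact: groth_map_surj.
- by case=> n y; congr (existT _ _ _); apply: oE.
- exact: shift_unit_nat.
Qed.

(** * Quotient by a contractible groupoid *)

Lemma sig_eq T (Q : T -> Prop) (u v : {x | Q x}) : sval u = sval v -> u = v.
Proof. by case: u v => [x p] [y q] /= e; case: y / e q => q; congr exist. Qed.

Lemma cid_eq T (Q Q' : T -> Prop) (p : exists x, Q x) (p' : exists x, Q' x) :
  Q = Q' -> sval (cid p) = sval (cid p').
Proof. by move=> e; case: Q' / e p' => p'; rewrite (Prop_irrelevance p p'). Qed.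

Definition familyF (Q E : nat -> category) (F : forall n, functor (E n) (Q n))
    k (n : 'I_k -> nat) :
    functor (prod_cat (sym_cat k) (pi_cat (fun i => E (n i))))
            (prod_cat (sym_cat k) (pi_cat (fun i => Q (n i)))) :=
  fprod (fid _) (fpi (fun i => F (n i))).

Section Descent.
Variables (E : sym_algebra) (Q : icategory).
Variables (p : forall n, functor (E n) (Q n)) (i : forall n, functor (Q n) (E n)).
Variable op : forall k (n : 'I_k -> nat),
  functor (prod_cat (sym_cat k) (pi_cat (fun i => Q (n i)))) (Q (\sum_i n i)).
Let S := sym_str E.
Local Notation pf n := (familyF p n).
Local Notation jf n := (familyF i n).

Hypothesis pK : forall n, p n \oF i n = fid (Q n).
Hypothesis map_p : forall m n (h : injection m n),
  icat_map Q h \oF p m = p n \oF icat_map E h.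
Hypothesis op_p : forall k (n : 'I_k -> nat), op n \oF pf n = p _ \oF sym_op S n.

Let pfK k (n : 'I_k -> nat) : pf n \oF jf n = fid _.
Proof.
transitivity (fprod (fid (sym_cat k)) (fpi (fun j => p (n j) \oF i (n j)))).
  exact: functor_irr.
have -> : (fun j => p (n j) \oF i (n j)) = (fun j => fid (Q (n j))).
  by apply: functional_extensionality_dep => j; apply: pK.
by apply: functor_arr => -[[s x] [t y] [h u]].
Qed.

Let epi C C' D (a : functor C C') (b : functor C' C) (F G : functor C' D) :
  a \oF b = fid C' -> F \oF a = G \oF a -> F = G.
Proof.
move=> ab e.
have K (H : functor C' D) : H \oF a \oF b = H by rewrite -fcompA ab fcompf1.
by rewrite -[F]K e K.
Qed.

Let map_pf k (m n : 'I_k -> nat) (f : forall j, injection (m j) (n j)) :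
  fprod (fid (sym_cat k)) (fpi (fun j => icat_map Q (f j))) \oF pf m
  = pf n \oF fprod (fid (sym_cat k)) (fpi (fun j => icat_map E (f j))).
Proof.
transitivity (fprod (fid (sym_cat k)) (fpi (fun j => icat_map Q (f j) \oF p (m j)))).
  exact: functor_irr.
have -> : (fun j => icat_map Q (f j) \oF p (m j)) = (fun j => p (n j) \oF icat_map E (f j)).
  by apply: functional_extensionality_dep => j; apply: map_p.
exact: functor_irr.
Qed.

Let op_pE k (n : 'I_k -> nat) D
    (X : functor D (prod_cat (sym_cat k) (pi_cat (fun j => E (n j))))) :
  op n \oF (pf n \oF X) = p _ \oF (sym_op S n \oF X).
Proof. by rewrite fcompA op_p -fcompA. Qed.

Let map_op k (n : 'I_k -> nat) m (h : injection (\sum_j n j) m) D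
    (X : functor D (prod_cat (sym_cat k) (pi_cat (fun j => E (n j))))) :
  icat_map Q h \oF (op n \oF (pf n \oF X))
  = p _ \oF (icat_map E h \oF sym_op S n \oF X).
Proof. by rewrite op_pE fcompA map_p -!fcompA. Qed.

(** Having a section, [p] is an epimorphism, and so are the induced functors on families. Each axiom
    may therefore be checked after precomposition with [p], where it becomes the axiom for E. *)
Definition descent_structure : sym_structure Q.
Proof.
exists op.
- move=> k m n f; apply: (epi (pfK m)).
  rewrite -(fcompA (icat_map Q _)) -(fcompA (op n)) map_pf op_pE op_p.
  by rewrite fcompA map_p -fcompA sym_nat.
- move=> k s n; apply: (epi (pfK n)).
  transitivity (icat_map Q (block s n)
    \oF (op n \oF (pf n \oF fprod (sym_act s) (fid _)))); first exact: functor_irr.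
  rewrite map_op sym_equiv -op_pE; exact: functor_irr.
- move=> n; apply: (epi (pK n)).
  transitivity (icat_map Q (inj_cast (sum_ord1 n)) \oF (op (fun=> n)
    \oF (pf (fun=> n) \oF fpair (fconst (1%g : sym_cat 1)) (ftuple (fun=> fid (E n)))))).
    exact: functor_irr.
  by rewrite map_op sym_unit fcompf1 fcomp1f.
- move=> k j n.
  (* Associativity lives on families of families, so the epimorphism and its section are taken at
     both levels. *)
  pose pp := fprod (fid (sym_cat k)) (fpi (fun l => pf (n l))).
  pose ii := fprod (fid (sym_cat k)) (fpi (fun l => jf (n l))).
  have ppii : pp \oF ii = fid _.
    transitivity (fprod (fid (sym_cat k)) (fpi (fun l => pf (n l) \oF jf (n l)))).
      exact: functor_irr.
    have -> : (fun l => pf (n l) \oF jf (n l)) = (fun l => fid _).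
      by apply: functional_extensionality_dep => l; apply: pfK.
    by apply: functor_arr => -[[s x] [t y] [h u]].
  apply: (epi ppii).
  have opp : fprod (fid (sym_cat k)) (fpi (fun l => op (n l))) \oF pp
    = pf _ \oF fprod (fid (sym_cat k)) (fpi (fun l => sym_op S (n l))).
    transitivity (fprod (fid (sym_cat k)) (fpi (fun l => op (n l) \oF pf (n l)))).
      exact: functor_irr.
    have -> : (fun l => op (n l) \oF pf (n l)) = (fun l => p _ \oF sym_op S (n l)).
      by apply: functional_extensionality_dep => l; apply: op_p.
    exact: functor_irr.
  transitivity (icat_map Q (inj_cast (flatten_sum n)) \oF (op (fun l => \sum_t n l t)
       \oF (fprod (fid (sym_cat k)) (fpi (fun l => op (n l))) \oF pp))).
    exact: functor_irr.
  rewrite opp map_op sym_assoc -op_pE; exact: functor_irr.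
Defined.

End Descent.

Section Quotient.
Variable E : sym_algebra.
Let S := sym_str E.

Variable th : forall n (x y : E n), hom x y -> Prop.
Hypothesis th_id : forall n (x : E n), th (idm x).
Hypothesis th_thin : forall n (x y : E n) (f f' : hom x y), th f -> th f' -> f = f'.
Hypothesis th_comp : forall n (x y z : E n) (g : hom y z) (f : hom x y),
  th f -> th g -> th (g \oc f).
Hypothesis th_inv : forall n (x y : E n) (f : hom x y),
  th f -> exists g : hom y x, th g.
Hypothesis th_map : forall m n (h : injection m n) (x y : E m) (f : hom x y),
  th f -> th (fmap (icat_map E h) f).
Hypothesis th_op : forall k (n : 'I_k -> nat)
    (x y : prod_cat (sym_cat k) (pi_cat (fun i => E (n i)))) (u : hom x y),
  (forall i, th (u.2 i)) -> th (fmap (sym_op S n) u).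

Definition related n (x y : E n) : Prop := exists f : hom x y, th f.

Lemma related_class n (x y : E n) : related x y -> related x = related y.
Proof.
case=> f tf; have [g tg] := th_inv tf; apply: funext => z; apply: propext.
split=> -[h tlh]; first by exists (h \oc g); apply: th_comp.
by exists (h \oc f); apply: th_comp.
Qed.

Lemma related_refl n (x : E n) : related x x.
Proof. by exists (idm x); apply: th_id. Qed.

(** The quotient is realized on chosen representatives, between which morphisms are those of E. The
    choice is made from the predicate [related x], and equal predicates give the same choice; hence
    [rep] is constant on classes. *)
Definition rep n (x : E n) : E n :=
  sval (cid (ex_intro (related x) x (related_refl x))).

Lemma rep_related n (x : E n) : related x (rep x).
Proof. exact: svalP (cid _). Qed.

Lemma rep_eq n (x y : E n) : related x y -> rep x = rep y.
Proof.
by move=> /related_class e; apply: cid_eq.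
Qed.

Definition to_rep n (x : E n) : hom x (rep x) := sval (cid (rep_related x)).

Lemma to_repP n (x : E n) : th (to_rep x).
Proof. exact: svalP (cid _). Qed.

Definition of_rep n (x : E n) : hom (rep x) x := sval (cid (th_inv (to_repP x))).

Lemma of_repP n (x : E n) : th (of_rep x).
Proof. exact: svalP (cid _). Qed.

Lemma to_repK n (x : E n) : of_rep x \oc to_rep x = idm x.
Proof. apply: th_thin (th_id _); apply: th_comp; [exact: to_repP | exact: of_repP]. Qed.

Lemma of_repK n (x : E n) : to_rep x \oc of_rep x = idm (rep x).
Proof. apply: th_thin (th_id _); apply: th_comp; [exact: of_repP | exact: to_repP]. Qed.

Lemma th_idto n (x y : E n) (e : x = y) : th (idto e).
Proof. by case: y / e; apply: th_id. Qed.

Lemma rep_idem n (x : E n) : rep (rep x) = rep x.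
Proof. exact/esym/rep_eq/rep_related. Qed.

Definition quo n : category := pull (fun x : {x : E n | rep x = x} => sval x).

Definition quo_incl n : functor (quo n) (E n) := pullF _.

Definition quo_proj n : functor (E n) (quo n).
Proof.
exists (fun x => exist _ (rep x) (rep_idem x) : quo n)
  (fun x y f => to_rep y \oc f \oc of_rep x).
- by move=> x; rewrite /= compm1 of_repK.
- move=> x y z g f /=; rewrite !compA; congr (_ \oc _).
  by rewrite -!compA (compA _ (to_rep y) f) to_repK comp1m.
Defined.

(** By thinness, the composite rep x -> x -> x' -> rep x' lies in [th] between equal objects, so it
    is an identity; the square then collapses to an equality of arrows. *)
Lemma quo_proj_arr n (x y x' y' : E n) (u : hom x y) (u' : hom x' y')
    (t : hom x x') (t' : hom y y') :
  th t -> th t' -> u' \oc t = t' \oc u ->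
  amap (quo_proj n) (Arr u) = amap (quo_proj n) (Arr u').
Proof.
move=> tt tt' e.
have ex : rep x = rep x' by apply: rep_eq; exists t.
have ey : rep y = rep y' by apply: rep_eq; exists t'.
apply: pull_arr; [exact: sig_eq|exact: sig_eq|].
rewrite -[LHS]/(Arr (to_rep y \oc u \oc of_rep x)).
rewrite -[RHS]/(Arr (to_rep y' \oc u' \oc of_rep x')).
have tx : idto ex = to_rep x' \oc t \oc of_rep x.
  apply: (th_thin (th_idto ex)); apply: th_comp; first exact: of_repP.
  by apply: th_comp; [|exact: to_repP].
have ty : idto ey = to_rep y' \oc t' \oc of_rep y.
  apply: (th_thin (th_idto ey)); apply: th_comp; first exact: of_repP.
  by apply: th_comp; [|exact: to_repP].
rewrite -(Arr_idtol _ ey) -[RHS](Arr_idtor _ ex) tx ty; congr Arr.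
rewrite !compA; congr (_ \oc _).
rewrite -!compA (compA (of_rep y)) to_repK comp1m (compA (of_rep x')) to_repK comp1m.
by rewrite e.
Qed.

(** The source of strictness: a natural isomorphism with components in [th] becomes an equality of
    functors after projection. *)
Lemma quo_proj_eq n C (H H' : functor C (E n)) (t : forall x, hom (H x) (H' x)) :
  (forall x, th (t x)) ->
  (forall x y (f : hom x y), fmap H' f \oc t x = t y \oc fmap H f) ->
  quo_proj n \oF H = quo_proj n \oF H'.
Proof.
move=> tt e; apply: functor_arr => -[x y f].
exact: (quo_proj_arr (tt x) (tt y)).
Qed.

Lemma quo_inclK n : quo_proj n \oF quo_incl n = fid (quo n).
Proof.
apply: functor_arr => -[[x ex] [y ey] f].
apply: pull_arr; [exact: sig_eq|exact: sig_eq|].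
rewrite -[LHS]/(Arr (to_rep y \oc f \oc of_rep x)) -[RHS]/(@Arr (E n) x y f).
have -> : of_rep x = idto ex by apply: th_thin (th_idto _); apply: of_repP.
have -> : to_rep y = idto (esym ey) by apply: th_thin (th_idto _); apply: to_repP.
by rewrite Arr_idtor Arr_idtol.
Qed.

Lemma quo_proj_nat n (x y : E n) (f : hom x y) :
  f \oc of_rep x = of_rep y \oc fmap (quo_incl n \oF quo_proj n) f.
Proof.
rewrite -[fmap _ f]/(to_rep y \oc f \oc of_rep x) !compA to_repK.
by rewrite comp1m.
Qed.

Lemma quo_map_proj m n (h : injection m n) :
  quo_proj n \oF icat_map E h \oF quo_incl m \oF quo_proj m
  = quo_proj n \oF icat_map E h.
Proof.
rewrite -!fcompA.
apply: (@quo_proj_eq n _ (icat_map E h \oF (quo_incl m \oF quo_proj m)) (icat_map E h)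
  (fun x => fmap (icat_map E h) (of_rep x))) => [x|x y f].
  exact/th_map/of_repP.
transitivity (fmap (icat_map E h) (f \oc of_rep x)); first by rewrite fmapM.
by rewrite quo_proj_nat fmapM.
Qed.

Definition quo_icat : icategory.
Proof.
exists quo (fun m n h => quo_proj n \oF icat_map E h \oF quo_incl m).
- by move=> n; rewrite icat_map1 fcompf1 quo_inclK.
- move=> l m n g f; rewrite icat_mapM !fcompA; congr (_ \oF _).
  by rewrite quo_map_proj.
Defined.

Local Notation proj_family n := (@familyF quo_icat E (fun m => quo_proj m) _ n).
Local Notation incl_family n := (@familyF E quo_icat (fun m => quo_incl m) _ n).

Definition quo_op k (n : 'I_k -> nat) :
    functor (prod_cat (sym_cat k) (pi_cat (fun i => quo_icat (n i))))
            (quo_icat (\sum_i n i)) :=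
  quo_proj _ \oF sym_op S n \oF incl_family n.

Lemma quo_op_proj k (n : 'I_k -> nat) :
  quo_op n \oF proj_family n = quo_proj _ \oF sym_op S n.
Proof.
rewrite /quo_op -!fcompA.
pose v (x : prod_cat (sym_cat k) (pi_cat (fun i => E (n i)))) :
  hom (incl_family n (proj_family n x)) x := (idm x.1, fun i => of_rep (x.2 i)).
apply: (@quo_proj_eq _ _ (sym_op S n \oF (incl_family n \oF proj_family n)) (sym_op S n)
  (fun x => fmap (sym_op S n) (v x))) => [x|x y f].
  by apply: th_op => i; apply: of_repP.
have e : f \oc v x = v y \oc fmap (incl_family n \oF proj_family n) f.
  apply: (congr2 pair); first exact: etrans (compm1 _) (esym (comp1m _)).
  by apply: functional_extensionality_dep => i; apply: quo_proj_nat.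
transitivity (fmap (sym_op S n) (f \oc v x)); first by rewrite fmapM.
by rewrite e fmapM.
Qed.

Lemma quo_map_projE m n (h : injection m n) :
  icat_map quo_icat h \oF quo_proj m = quo_proj n \oF icat_map E h.
Proof. exact: quo_map_proj. Qed.

(** The symmetry from the order [x.1] to the order 1, with identities in the other arguments, lies
    in [th] by [th_op]; the projection turns it into an identity. *)
Lemma quo_op_const k (n : 'I_k -> nat) :
  quo_op n = quo_op n \oF fprod (fconst (1%g : sym_cat k)) (fid _).
Proof.
rewrite /quo_op -!fcompA.
pose c := fprod (@fconst (sym_cat k) (sym_cat k) (1%g : 'S_k))
  (fid (pi_cat (fun i => quo_icat (n i)))).
pose v (x : prod_cat (sym_cat k) (pi_cat (fun i => quo_icat (n i)))) :
  hom (incl_family n x) (incl_family n (c x)) :=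
  (sym_shift x.1 (1%g : 'S_k), fun i => idm (sval (x.2 i))).
apply: (@quo_proj_eq _ _ (sym_op S n \oF incl_family n)
  (sym_op S n \oF (incl_family n \oF c)) (fun x => fmap (sym_op S n) (v x)))
  => [x|x y f]; first by apply: th_op => i; apply: th_id.
have e : fmap (incl_family n \oF c) f \oc v x = v y \oc fmap (incl_family n) f.
  apply: (congr2 pair); first exact: sym_hom_irr.
  by apply: functional_extensionality_dep => i; exact: etrans (compm1 _) (esym (comp1m _)).
transitivity (fmap (sym_op S n) (fmap (incl_family n \oF c) f \oc v x)).
  by rewrite fmapM.
by rewrite e fmapM.
Qed.

Definition quo_algebra : sym_algebra :=
  SymAlgebra (@descent_structure E quo_icat (fun n => quo_proj n)
    (fun n => quo_incl n) (fun k n => quo_op n)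
    quo_inclK quo_map_projE quo_op_proj).

Definition quo_imap : imap E quo_algebra :=
  @IMap E quo_algebra quo_proj (fun m n h => quo_map_projE h).

Lemma quo_imap_sym : @sym_morphism E quo_algebra quo_imap.
Proof. by move=> k n; rewrite -[RHS]/(quo_op n \oF proj_family n) quo_op_proj. Qed.

Lemma quo_proj_inj n (x y : E n) (f g : hom x y) :
  fmap (quo_proj n) f = fmap (quo_proj n) g -> f = g.
Proof.
have K (u : hom x y) : u = of_rep y \oc fmap (quo_proj n) u \oc to_rep x.
  rewrite -[fmap _ u]/(to_rep y \oc u \oc of_rep x) !compA to_repK comp1m.
  by rewrite -compA to_repK compm1.
by move=> e; rewrite [f]K e -K.
Qed.

Lemma quo_proj_surj n (x y : E n) (h : hom (quo_proj n x) (quo_proj n y)) :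
  exists f, fmap (quo_proj n) f = h.
Proof.
exists (of_rep y \oc (h : hom (rep x) (rep y)) \oc to_rep x).
rewrite -[LHS]/(to_rep y \oc
  (of_rep y \oc (h : hom (rep x) (rep y)) \oc to_rep x) \oc of_rep x).
by rewrite !compA of_repK comp1m -compA of_repK; apply: compm1.
Qed.


Lemma quotient_I_equivalence : exists2 Q : sym_algebra,
  sym_I_equivalence E Q &
  forall k (n : 'I_k -> nat), sym_op (sym_str Q) n
    = sym_op (sym_str Q) n \oF fprod (fconst (1%g : sym_cat k)) (fid _).
Proof.
exists quo_algebra; last exact: quo_op_const.
exists quo_imap; first exact: quo_imap_sym.
apply: (@shift_I_equivalence _ _ quo_imap (fun n => quo_incl n.+1)).
- exact: quo_proj_inj.
- exact: quo_proj_surj.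
- by move=> n y; apply: (fob_eq (quo_inclK n.+1)).
Qed.

End Quotient.

(** * Trivial actions and strictly commutative monoids *)

Lemma Blk_eq (A : icategory) m n (a b : injection m n) (u : arr (A m)) :
  a =1 b -> Blk a u = Blk b u.
Proof. by move=> /injection_eq ->. Qed.

Section EvaluationMonoid.
Variable A : icategory.

(** [ev l u] expresses that [u] is the product of the blocks of [l]. *)
Variable ev : forall n, seq (ablk A n) -> arr (A n) -> Prop.
Variable tensor : forall m n, functor (prod_cat (A m) (A n)) (A (m + n)).
Variable unit0 : A 0.

Hypothesis ev_fun : forall n (l l' : seq (ablk A n)) u u',
  ev l u -> ev l' u' -> l = l' -> u = u'.
Hypothesis ev_push : forall m n (h : injection m n) l u,
  ev l u -> ev (map (push h) l) (amap (icat_map A h) u).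
Hypothesis ev1 : forall n (u : arr (A n)), ev [:: Blk (injection_id n) u] u.
Hypothesis ev_tensor : forall m n l l' (u : arr (prod_cat (A m) (A n))),
  ev l (amap ffst u) -> ev l' (amap fsnd u) ->
  ev (map (push (linj m n)) l ++ map (push (rinj m n)) l') (amap (tensor m n) u).
Hypothesis ev_unit : ev [::] (aid unit0).

Lemma ev_block m n (h : injection m n) (u : arr (A m)) :
  ev [:: Blk h u] (amap (icat_map A h) u).
Proof.
have := ev_push h (ev1 u); congr (ev [:: Blk _ _] _).
by apply: injection_eq => i; rewrite injection_compE injection_idE.
Qed.

Lemma ev_eq n (l l' : seq (ablk A n)) u : ev l u -> l = l' -> ev l' u.
Proof. by move=> e <-. Qed.

(** As for the other monoid laws, both sides are products of the same list of blocks, so [ev_fun]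
    identifies them once the injections are compared pointwise. *)
Fact tensor_nat m m' n n' (f : injection m m') (g : injection n n') :
  icat_map A (inj_add f g) \oF tensor m n
  = tensor m' n' \oF fprod (icat_map A f) (icat_map A g).
Proof.
apply: functor_arr => u; rewrite !amap_comp.
apply: (ev_fun (ev_push (inj_add f g) (ev_tensor (ev1 (amap ffst u)) (ev1 (amap fsnd u))))).
  exact: (ev_tensor (u := amap (fprod (icat_map A f) (icat_map A g)) u)
    (ev_block f (amap ffst u)) (ev_block g (amap fsnd u))).
congr [:: _; _]; apply: Blk_eq => i;
  rewrite !injection_compE injection_idE !inj_ofE.
  by rewrite (unsplitK (inl i)).
by rewrite (unsplitK (inr i)).
Qed.

Fact tensor_unitl n :
  icat_map A (inj_cast (add0n n)) \oF tensor 0 n \oF fpair (fconst unit0) (fid (A n))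
  = fid (A n).
Proof.
apply: functor_arr => -[x y f]; rewrite !amap_comp amap_id.
apply: (ev_fun (ev_push _ (ev_tensor (u := amap (fpair (fconst unit0) (fid (A n))) (Arr f))
  ev_unit (ev1 (Arr f)))) (ev1 (Arr f))).
congr [:: _]; apply: Blk_eq => i; apply: ord_inj.
by rewrite !injection_compE inj_castE !injection_idE rinjE.
Qed.

Fact tensor_unitr n :
  icat_map A (inj_cast (addn0 n)) \oF tensor n 0 \oF fpair (fid (A n)) (fconst unit0)
  = fid (A n).
Proof.
apply: functor_arr => -[x y f]; rewrite !amap_comp amap_id.
apply: (ev_fun (ev_push _ (ev_tensor (u := amap (fpair (fid (A n)) (fconst unit0)) (Arr f))
  (ev1 (Arr f)) ev_unit)) (ev1 (Arr f))).
congr [:: _]; apply: Blk_eq => i; apply: ord_inj.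
by rewrite !injection_compE inj_castE !injection_idE linjE.
Qed.

Fact tensor_assoc m n p :
  icat_map A (inj_cast (addnA m n p)) \oF tensor m (n + p)
    \oF fpair (ffst \oF ffst) (tensor n p \oF fpair (fsnd \oF ffst) fsnd)
  = tensor (m + n) p \oF fprod (tensor m n) (fid (A p)).
Proof.
apply: functor_arr => u; rewrite !amap_comp.
have e1 := ev1 (amap ffst (amap ffst u)).
have e2 := ev1 (amap fsnd (amap ffst u)).
have e3 := ev1 (amap fsnd u).
have e23 := ev_tensor (u := amap (fpair (fsnd \oF ffst) fsnd) u) e2 e3.
have e12 := ev_tensor (u := amap ffst u) e1 e2.
apply: (ev_fun
  (ev_push _ (ev_tensor (u := amap (fpair (ffst \oF ffst)
     (tensor n p \oF fpair (fsnd \oF ffst) fsnd)) u) e1 e23))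
  (ev_tensor (u := amap (fprod (tensor m n) (fid (A p))) u) e12 e3)).
congr [:: _; _; _]; apply: Blk_eq => i; apply: ord_inj;
  rewrite !injection_compE inj_castE !injection_idE ?(linjE, rinjE) //.
by rewrite addnA.
Qed.

Definition ev_monoid : monoid_structure A :=
  MonoidStructure tensor_nat tensor_unitl tensor_unitr tensor_assoc.

Lemma ev_iter_tensor k (n : 'I_k -> nat) (u : arr (pi_cat (fun i => A (n i)))) :
  ev [seq Blk (incl n i) (amap (fproj i) u) | i <- enum 'I_k]
     (amap (iter_tensor ev_monoid n) u).
Proof.
elim: k n u => [|k IH] n u.
  rewrite (size0nil (size_enum_ord 0)) /=.
  rewrite -[amap _ _]/(aid (icat_map A (inj_cast (sum_ord0 n)) unit0)) -amap_aid.
  exact: (ev_push _ ev_unit).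
rewrite [iter_tensor _ _]/= !amap_comp.
have := ev_push (inj_cast (sum_ordS n)) (ev_tensor (m := n ord0) (u := amap (fpair (fproj ord0)
  (iter_tensor ev_monoid (fun i => n (lift ord0 i)) \oF ftuple (fun i => fproj (lift ord0 i)))) u)
   (ev1 _) (IH _ (amap (ftuple (fun i => fproj (lift ord0 i))) u))).
move/ev_eq; apply; rewrite enum_ordSl /=; congr (_ :: _).
  apply: Blk_eq => i; apply: ord_inj.
  rewrite !injection_compE inj_castE linjE injection_idE inclE tagnat.RankEsum.
  by rewrite big1.
(* The offset of the block [lift ord0 i] is [n ord0] plus its offset among the remaining blocks. *)
rewrite -!map_comp; apply: eq_map => i /=; apply: Blk_eq => t; apply: ord_inj.
rewrite !injection_compE inj_castE rinjE !inclE !tagnat.RankEsum addnA.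
by rewrite [in RHS]big_mkcond big_ord_recl [in LHS]big_mkcond.
Qed.

Hypothesis ev_tensorC : forall m n (u : arr (prod_cat (A m) (A n))),
  ev [:: Blk (rinj m n) (amap fsnd u); Blk (linj m n) (amap ffst u)]
     (amap (tensor m n) u).

(** Listing the factors of the left side in the opposite order does not change their product; after
    pushing along [chi], the list is that of the right side. *)
Lemma ev_monoid_comm : strictly_commutative ev_monoid.
Proof.
move=> m n; apply: functor_arr => u; rewrite !amap_comp.
apply: (ev_fun (ev_push (chi m n) (ev_tensorC u))
  (ev_tensor (u := amap (fpair fsnd ffst) u) (ev1 (amap fsnd u)) (ev1 (amap ffst u)))).
congr [:: _; _]; apply: Blk_eq => i;
  rewrite !injection_compE injection_idE !inj_ofE.
  by rewrite (unsplitK (inr i)).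
by rewrite (unsplitK (inl i)).
Qed.

End EvaluationMonoid.

Section TrivialAction.
Variables (A : icategory) (S : sym_structure A).
Hypothesis triv : forall k (n : 'I_k -> nat),
  sym_op S n = sym_op S n \oF fprod (fconst (1%g : sym_cat k)) (fid _).

Lemma opA_triv k (n : 'I_k -> nat) s t (f : forall i, arr (A (n i))) :
  opA S s t f = opA S 1%g 1%g f.
Proof. by rewrite /opA {1}triv amap_comp amap_sym_op. Qed.

Lemma opB_triv n k (g : 'I_k -> ablk A n) (d : disj (fun i => bi (g i))) s t :
  opB S d s t = opB S d 1%g 1%g.
Proof. by rewrite /opB opA_triv. Qed.

Definition ev n (l : seq (ablk A n)) (u : arr (A n)) : Prop := gev S l l u.

Lemma evI n k (g : 'I_k -> ablk A n) (d : disj (fun i => bi (g i))) s t r :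
  ev (lst s g) (opB S d t r).
Proof.
have <- : opB S d s s = opB S d t r by rewrite opB_triv [RHS]opB_triv.
exact: gevI.
Qed.

(** Repeated blocks may leave the permutation ambiguous, but a trivial action does not see it. *)
Lemma ev_fun n (l l' : seq (ablk A n)) u u' : ev l u -> ev l' u' -> l = l' -> u = u'.
Proof.
move=> /gevE [k [g [d [r [-> _ ->]]]]] e' e.
move: e'; rewrite /ev -e -lst1 => /gevE_lst [d' [r' [_ ->]]].
by rewrite (Prop_irrelevance d d') opB_triv [RHS]opB_triv.
Qed.

Lemma ev_push m n (h : injection m n) l u :
  ev l u -> ev (map (push h) l) (amap (icat_map A h) u).
Proof. exact: gev_push. Qed.

Lemma ev1 n (u : arr (A n)) : ev [:: Blk (injection_id n) u] u.
Proof. exact: gev1. Qed.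

Section Tensor.
Variables m n : nat.

(** The two factors are indexed by natural numbers, so that families over ['I_2] are defined by a
    match that reduces. *)
Let two (b : nat) : nat := if b is 0 then m else n.

Let inj2 (b : nat) : injection (two b) (m + n) :=
  match b with 0 => linj m n | _.+1 => rinj m n end.

Let sel (b : nat) : functor (prod_cat (A m) (A n)) (A (two b)) :=
  match b with 0 => ffst | _.+1 => fsnd end.

Fact disj2 : disj (fun i : 'I_2 => inj2 i).
Proof.
move=> [[|[|//]] p] [[|[|//]] q] t u /= /(congr1 (@nat_of_ord _));
  rewrite ?(linjE, rinjE) => e; apply: ord_inj => //=.
  by have := ltn_ord t; rewrite e ltnNge leq_addr.
by have := ltn_ord u; rewrite -e ltnNge leq_addr.
Qed.

(** The binary operation of Sym; gluing along the two inclusions takes the place of a cast from the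
    sum over ['I_2] to [m + n]. *)
Definition tensor : functor (prod_cat (A m) (A n)) (A (m + n)) :=
  icat_map A (glue disj2) \oF sym_op S (fun i : 'I_2 => two i)
    \oF fpair (fconst (1%g : sym_cat 2)) (ftuple (fun i : 'I_2 => sel i)).

Let blk2 (u : arr (prod_cat (A m) (A n))) (i : 'I_2) : ablk A (m + n) :=
  Blk (inj2 i) (amap (sel i) u).

Let tensorE u : amap tensor u = opB S (disj2 : disj (fun i => bi (blk2 u i))) 1%g 1%g.
Proof. by rewrite /tensor !amap_comp [X in amap _ X]amap_sym_op. Qed.

Lemma enum_ord2 : enum 'I_2 = [:: ord0; ord_max].
Proof.
rewrite enum_ordSl enum_ord1 /=; congr [:: _; _]; exact: ord_inj.
Qed.

Lemma ev_tensor l l' (u : arr (prod_cat (A m) (A n))) :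
  ev l (amap ffst u) -> ev l' (amap fsnd u) ->
  ev (map (push (linj m n)) l ++ map (push (rinj m n)) l') (amap tensor u).
Proof.
move=> el el'; rewrite tensorE.
pose L (b : nat) : seq (ablk A (two b)) := match b with 0 => l | _.+1 => l' end.
have := @gev_flatten A S _ _ (blk2 u) disj2 (fun i => L i) (fun i => L i) 1%g 1%g.
rewrite lst1 enum_ord2 /= cats0; apply.
by case=> [[|[|//]] p].
Qed.

Lemma ev_tensorC (u : arr (prod_cat (A m) (A n))) :
  ev [:: Blk (rinj m n) (amap fsnd u); Blk (linj m n) (amap ffst u)] (amap tensor u).
Proof.
rewrite tensorE.
have := evI (disj2 : disj (fun i => bi (blk2 u i))) (tperm ord0 ord_max) 1%g 1%g.
by rewrite /lst enum_ord2 /= tpermV tpermL tpermR.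
Qed.

End Tensor.

Let no_ob (i : 'I_0) : A 0 := False_rect _ (notF (ltn_ord i)).

Fact disj0 : disj (fun i : 'I_0 => injection_id 0).
Proof. by case. Qed.

Definition unit0 : A 0 :=
  icat_map A (glue disj0) (sym_op S (fun=> 0) (1%g : 'S_0, no_ob)).

Lemma ev_unit : ev [::] (aid unit0).
Proof.
have := evI (disj0 : disj (fun i => bi (Blk (injection_id 0) (aid (no_ob i))))) 1%g 1%g 1%g.
rewrite lst1 (size0nil (size_enum_ord 0)) /=; congr (ev _ _).
by rewrite /opB (opA_id S (n := fun=> 0)) amap_aid.
Qed.

Definition triv_monoid : monoid_structure A :=
  ev_monoid ev_fun ev_push ev1 ev_tensor ev_unit.

(** Both functors produce the product of the components placed along the inclusions, in their given
    order, so [ev_fun] applies. *)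
Lemma triv_sym_of_monoid : sym_of_monoid triv_monoid S.
Proof.
move=> k n; apply: functor_arr => u; rewrite [RHS]amap_comp.
have e := ev_iter_tensor ev_fun ev_push ev1 ev_tensor ev_unit (amap fsnd u); apply/esym/(ev_fun e).
  have := evI (@disj_incl k n : disj (fun i => bi (Blk (incl n i) (Arr ((amor u).2 i))))) 1%g.
  move=> /(_ (asrc u).1 (atgt u).1); rewrite /opB glue_inclE icat_amap1.
  by rewrite -[u in amap _ u]arr_eta amap_sym_op; apply.
by rewrite lst1.
Qed.

Lemma triv_monoid_comm : strictly_commutative triv_monoid.
Proof. exact/ev_monoid_comm/ev_tensorC. Qed.

End TrivialAction.

(** * The chain of equivalences *)

Section Letter.
Variable A : sym_algebra.

Fact letter_subproof n (a : A n.+1) :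
  let l := [:: Blk (injection_id n.+1) (aid a)] in
  goods l /\ gev (sym_str A) l l (aid a).
Proof.
split; last exact: gev1.
by rewrite /goods /= andbT; apply/asboolP; split=> //; exists a.
Qed.

(** A single letter filling the whole set, admissible because the degree is positive; it provides
    the preimages that [shift_I_equivalence] asks for. *)
Definition letter n (a : A n.+1) : words A n.+1 := Word (letter_subproof a).

Lemma words_I_equivalence : sym_I_equivalence (words_algebra A) A.
Proof.
exists (words_value A); first exact: words_value_sym.
apply: (@shift_I_equivalence _ _ (words_value A) letter) => //.
by move=> n x y h; exists h.
Qed.

End Letter.

Theorem theorem7p1 (A : sym_algebra) :
  exists (B : icategory) (M : monoid_structure B) (S : sym_structure B),
    strictly_commutative M /\ sym_of_monoid M S /\
    I_equivalent A (SymAlgebra S).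
Proof.
have [Q W trivQ] := @quotient_I_equivalence (words_algebra A) (@reorder A)
  (@reorder_id A) (@reorder_thin A) (@reorder_comp A) (@reorder_inv A)
  (@reorder_map A) (@reorder_op A).
exists Q, (triv_monoid trivQ), (sym_str Q); split; first exact: triv_monoid_comm.
split; first exact: triv_sym_of_monoid.
(* The chain has two steps, with [words_algebra A] mapping both to A and to its quotient [Q]. *)
apply: (@rst_trans _ _ _ (words_algebra A)).
  by apply/rst_sym/rst_step/words_I_equivalence.
by apply: rst_step; case: Q W {trivQ}.
Qed.
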